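(* Let $R$ be a regular finitely generated algebra over an $F$-finite regular local ring of characteristic $p>0$. Let $f\in R$ be a nonzero element. Then the $D_R$-module $R_f$ is generated by $\frac{1}{f}$.
   Context: Rings are commutative. A ring $A$ of characteristic $p$ is $F$-finite if it is a finitely generated module over its subring $A^p$ of $p$-th powers. Differential operators $\delta:R\to R$ of order $\le n$ are defined inductively: those of order $0$ are the multiplications $\tilde r$ by elements $r\in R$; those of order $\le n$ are the additive maps $\delta$ with $\delta\circ\tilde r-\tilde r\circ\delta$ of order $\le n-1$ for all $r\in R$. They form the ring $D_R$; modules over it are left modules. $R_f$ is the localization of $R$ inverting $f$, with the unique $D_R$-module structure for which the localization map $R\to R_f$ is $D_R$-linear. *)

(* Defs.v *)
From HB Require Import structures.
From mathcomp Require Import all_boot all_order all_algebra.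
From mathcomp Require Import ring.
From mathcomp Require Import boolp.

Set Implicit Arguments.
Unset Strict Implicit.
Unset Printing Implicit Defensive.

Import GRing.Theory.
Local Open Scope ring_scope.
Local Open Scope quotient_scope.

(* The localization of R at S is built from pairs (r, s) with s in S, where   *)
(* (r, s) ~ (r', s') iff t (r s' - r' s) = 0 for some t in S. It is only a    *)
(* [comPzRingType]: it is the zero ring when 0 is in S.                       *)
Section Localization.
Variables (R : comNzRingType) (S : mulrClosed R).

Record denom := Denom { denom_val : R; denomP : denom_val \in S }.
HB.instance Definition _ := [isSub for denom_val].
HB.instance Definition _ := [Choice of denom by <:].

Definition preloc := (R * denom)%type.
HB.instance Definition _ := Choice.on preloc.

Definition denom1 : denom := Denom (rpred1 S).
Fact denomM_subproof (s t : denom) : denom_val s * denom_val t \in S.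
Proof. exact: rpredM (denomP s) (denomP t). Qed.
Definition denomM s t := Denom (denomM_subproof s t).

Definition loc_rel (x y : preloc) : bool :=
  `[< exists2 t, t \in S & t * (x.1 * denom_val y.2) = t * (y.1 * denom_val x.2) >].

Fact loc_rel_refl : reflexive loc_rel.
Proof. by move=> x; apply/asboolP; exists 1; rewrite ?rpred1. Qed.

Fact loc_rel_sym : symmetric loc_rel.
Proof.
by move=> x y; apply/asboolP/asboolP => -[t tS e]; exists t.
Qed.

Fact loc_rel_trans : transitive loc_rel.
Proof.
move=> [y [b bS]] [x [a aS]] [z [c cS]] /asboolP[t tS /= e1] /asboolP[u uS /= e2].
apply/asboolP; exists (t * u * b); first by rewrite !rpredM.
rewrite /=.
transitivity ((u * c) * (t * (x * b))); first by ring.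
rewrite e1; transitivity ((t * a) * (u * (y * c))); first by ring.
by rewrite e2; ring.
Qed.

Canonical loc_rel_equiv := EquivRel loc_rel loc_rel_refl loc_rel_sym loc_rel_trans.

Definition loc := {eq_quot loc_rel}.

HB.instance Definition _ : EqQuotient _ loc_rel loc := EqQuotient.on loc.
HB.instance Definition _ := Choice.on loc.

Definition locfrac (r : R) (s : denom) : loc := \pi_loc (r, s).

Lemma locfrac_eq r s r' s' :
  locfrac r s = locfrac r' s' <->
  exists2 t, t \in S & t * (r * denom_val s') = t * (r' * denom_val s).
Proof.
split; first by move/eqmodP => /= /asboolP.
by move=> h; apply/eqmodP => /=; apply/asboolP.
Qed.

Lemma locfrac_ind (P : loc -> Prop) : (forall r s, P (locfrac r s)) -> forall x, P x.
Proof. by move=> h; elim/quotW => -[r s]; apply: h. Qed.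

Definition loc_num (x : loc) : R := (repr x).1.
Definition loc_den (x : loc) : denom := (repr x).2.

Lemma loc_numden x : locfrac (loc_num x) (loc_den x) = x.
Proof. by rewrite /locfrac /loc_num /loc_den -surjective_pairing reprK. Qed.

Definition loc_zero : loc := locfrac 0 denom1.
Definition loc_one : loc := locfrac 1 denom1.
Definition loc_opp (x : loc) : loc := locfrac (- loc_num x) (loc_den x).
Definition loc_add (x y : loc) : loc :=
  locfrac (loc_num x * denom_val (loc_den y) + loc_num y * denom_val (loc_den x))
          (denomM (loc_den x) (loc_den y)).
Definition loc_mul (x y : loc) : loc :=
  locfrac (loc_num x * loc_num y) (denomM (loc_den x) (loc_den y)).

Lemma loc_oppE r s : loc_opp (locfrac r s) = locfrac (- r) s.
Proof.
have /locfrac_eq[t tS e] := loc_numden (locfrac r s).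
by apply/locfrac_eq; exists t => //; rewrite !mulNr !mulrN e.
Qed.

Lemma loc_addE r s r' s' :
  loc_add (locfrac r s) (locfrac r' s') =
  locfrac (r * denom_val s' + r' * denom_val s) (denomM s s').
Proof.
have /locfrac_eq[t tS e] := loc_numden (locfrac r s).
have /locfrac_eq[t' tS' e'] := loc_numden (locfrac r' s').
rewrite /loc_add; move: (loc_num (locfrac r s)) (loc_den (locfrac r s))
  (loc_num (locfrac r' s')) (loc_den (locfrac r' s')) e e'.
move=> a b a' b' e e'; apply/locfrac_eq; exists (t * t'); first exact: rpredM.
rewrite /=.
transitivity (t' * (denom_val b' * denom_val s') * (t * (a * denom_val s)) +
   t * (denom_val b * denom_val s) * (t' * (a' * denom_val s'))); first by ring.
by rewrite e e'; ring.
Qed.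

Lemma loc_mulE r s r' s' :
  loc_mul (locfrac r s) (locfrac r' s') = locfrac (r * r') (denomM s s').
Proof.
have /locfrac_eq[t tS e] := loc_numden (locfrac r s).
have /locfrac_eq[t' tS' e'] := loc_numden (locfrac r' s').
rewrite /loc_mul; move: (loc_num (locfrac r s)) (loc_den (locfrac r s))
  (loc_num (locfrac r' s')) (loc_den (locfrac r' s')) e e'.
move=> a b a' b' e e'; apply/locfrac_eq; exists (t * t'); first exact: rpredM.
rewrite /=.
transitivity ((t * (a * denom_val s)) * (t' * (a' * denom_val s'))); first by ring.
by rewrite e e'; ring.
Qed.

Fact loc_addA : associative loc_add.
Proof.
elim/locfrac_ind=> a s; elim/locfrac_ind=> b t; elim/locfrac_ind=> c u.
by rewrite !loc_addE; apply/locfrac_eq; exists 1; rewrite ?rpred1 //=; ring.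
Qed.

Fact loc_addC : commutative loc_add.
Proof.
elim/locfrac_ind=> a s; elim/locfrac_ind=> b t.
by rewrite !loc_addE; apply/locfrac_eq; exists 1; rewrite ?rpred1 //=; ring.
Qed.

Fact loc_add0 : left_id loc_zero loc_add.
Proof.
elim/locfrac_ind=> a s.
by rewrite !loc_addE; apply/locfrac_eq; exists 1; rewrite ?rpred1 //=; ring.
Qed.

Fact loc_addN : left_inverse loc_zero loc_opp loc_add.
Proof.
elim/locfrac_ind=> a s; rewrite loc_oppE loc_addE.
by apply/locfrac_eq; exists 1; rewrite ?rpred1 //=; ring.
Qed.

HB.instance Definition _ :=
  GRing.isZmodule.Build loc loc_addA loc_addC loc_add0 loc_addN.

Fact loc_mulA : associative loc_mul.
Proof.
elim/locfrac_ind=> a s; elim/locfrac_ind=> b t; elim/locfrac_ind=> c u.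
by rewrite !loc_mulE; apply/locfrac_eq; exists 1; rewrite ?rpred1 //=; ring.
Qed.

Fact loc_mulC : commutative loc_mul.
Proof.
elim/locfrac_ind=> a s; elim/locfrac_ind=> b t.
by rewrite !loc_mulE; apply/locfrac_eq; exists 1; rewrite ?rpred1 //=; ring.
Qed.

Fact loc_mul1 : left_id loc_one loc_mul.
Proof.
elim/locfrac_ind=> a s.
by rewrite !loc_mulE; apply/locfrac_eq; exists 1; rewrite ?rpred1 //=; ring.
Qed.

Fact loc_mulD : left_distributive loc_mul loc_add.
Proof.
elim/locfrac_ind=> a s; elim/locfrac_ind=> b t; elim/locfrac_ind=> c u.
rewrite loc_addE !loc_mulE loc_addE.
by apply/locfrac_eq; exists 1; rewrite ?rpred1 //=; ring.
Qed.

HB.instance Definition _ :=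
  GRing.Zmodule_isComPzRing.Build loc loc_mulA loc_mulC loc_mul1 loc_mulD.

Lemma addlE r s r' s' : locfrac r s + locfrac r' s' =
  locfrac (r * denom_val s' + r' * denom_val s) (denomM s s').
Proof. exact: loc_addE. Qed.

Lemma mullE r s r' s' :
  locfrac r s * locfrac r' s' = locfrac (r * r') (denomM s s').
Proof. exact: loc_mulE. Qed.

Definition toloc (r : R) : loc := locfrac r denom1.

Fact toloc_zmod_morphism : zmod_morphism toloc.
Proof.
move=> a b; rewrite [- toloc b]loc_oppE addlE.
by apply/locfrac_eq; exists 1; rewrite ?rpred1 //=; ring.
Qed.

Fact toloc_monoid_morphism : monoid_morphism toloc.
Proof.
split=> // a b; rewrite mullE.
by apply/locfrac_eq; exists 1; rewrite ?rpred1 //=; ring.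
Qed.

HB.instance Definition _ :=
  GRing.isZmodMorphism.Build R loc toloc toloc_zmod_morphism.
HB.instance Definition _ :=
  GRing.isMonoidMorphism.Build R loc toloc toloc_monoid_morphism.

Lemma toloc_frac r s : toloc (denom_val s) * locfrac r s = toloc r.
Proof.
by rewrite mullE; apply/locfrac_eq; exists 1; rewrite ?rpred1 //=; ring.
Qed.

Lemma toloc_inv s : toloc (denom_val s) * locfrac 1 s = 1.
Proof. exact: toloc_frac. Qed.

Lemma toloc_injl s x y : toloc (denom_val s) * x = toloc (denom_val s) * y -> x = y.
Proof.
by move=> e; rewrite -[x]mul1r -[y]mul1r -(toloc_inv s) mulrAC e mulrAC.
Qed.

End Localization.

Definition powers (R : comNzRingType) (f : R) : {pred R} :=
  fun x => `[< exists n, x = f ^+ n >].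

Fact powers_mulr_closed (R : comNzRingType) (f : R) : mulr_closed (powers f).
Proof.
split; first by apply/asboolP; exists 0%N.
move=> _ _ /asboolP[m ->] /asboolP[n ->]; apply/asboolP.
by exists (m + n)%N; rewrite exprD.
Qed.

HB.instance Definition _ (R : comNzRingType) (f : R) :=
  GRing.isMulClosed.Build R (powers f) (powers_mulr_closed f).

Fact powers_id (R : comNzRingType) (f : R) : f \in powers f.
Proof. by apply/asboolP; exists 1%N. Qed.

Definition away_inv (R : comNzRingType) (f : R) : loc (powers f) :=
  locfrac 1 (Denom (powers_id f)).

Definition prime_compl (R : comNzRingType) (P : prime_idealr R) : {pred R} :=
  fun x => x \notin P.

Fact prime_compl_mulr_closed (R : comNzRingType) (P : prime_idealr R) :
  mulr_closed (prime_compl P).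
Proof.
split; first by rewrite unfold_in /prime_compl idealr1.
move=> x y; rewrite ![_ \in prime_compl P]unfold_in /prime_compl.
by rewrite prime_idealrM => /negPf-> /negPf->.
Qed.

HB.instance Definition _ (R : comNzRingType) (P : prime_idealr R) :=
  GRing.isMulClosed.Build R (prime_compl P) (prime_compl_mulr_closed P).

Definition loc_at (R : comNzRingType) (P : prime_idealr R) := loc (prime_compl P).
HB.instance Definition _ (R : comNzRingType) (P : prime_idealr R) :=
  GRing.ComPzRing.on (loc_at P).

Fact loc_at_nonzero (R : comNzRingType) (P : prime_idealr R) :
  1 != 0 :> loc_at P.
Proof.
apply/eqP => /locfrac_eq[t]; rewrite unfold_in /prime_compl /= !mulr1 mulr0.
by move=> + e; rewrite e idealr0.
Qed.

HB.instance Definition _ (R : comNzRingType) (P : prime_idealr R) :=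
  GRing.PzSemiRing_isNonZero.Build (loc_at P) (@loc_at_nonzero R P).

(* In MathComp an [idealr] is by definition proper. *)

Definition generates_ideal (R : comNzRingType) (s : seq R) (I : {pred R}) : Prop :=
  forall x, x \in I <->
    exists c : 'I_(size s) -> R, x = \sum_(i < size s) c i * s`_i.

(* The unit ideal, which is not an [idealr], is generated by 1. *)
Definition noetherian (R : comNzRingType) : Prop :=
  forall I : idealr R, exists s : seq R, generates_ideal s I.

Definition maximal_ideal (R : comNzRingType) (m : idealr R) : Prop :=
  forall I : idealr R, {subset m <= I} -> I =i m.

Definition local_ring (R : comNzRingType) (m : idealr R) : Prop :=
  maximal_ideal m /\ forall m' : idealr R, maximal_ideal m' -> m' =i m.

(* Strict chains P 0 < ... < P n; the values P i for i > n are irrelevant. *)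
Definition prime_chain (R : comNzRingType) (n : nat) : Prop :=
  exists P : nat -> prime_idealr R, forall i, (i < n)%N ->
    {subset P i <= P i.+1} /\ ~ {subset P i.+1 <= P i}.

Definition krull_dim (R : comNzRingType) (d : nat) : Prop :=
  prime_chain R d /\ forall n, prime_chain R n -> (n <= d)%N.

(* The maximal ideal is generated by dim R elements; the dimension is         *)
(* required to be finite.                                                     *)
Definition regular_local (R : comNzRingType) : Prop :=
  noetherian R /\
  exists2 m : idealr R, local_ring m &
    exists2 d, krull_dim R d & exists s : d.-tuple R, generates_ideal s m.

Definition regular (R : comNzRingType) : Prop :=
  noetherian R /\ forall P : prime_idealr R, regular_local (loc_at P).

(* g generates A as a module over the subring of the c ^+ p. *)
Definition F_finite (p : nat) (A : comNzRingType) : Prop :=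
  exists g : seq A, forall a, exists c : 'I_(size g) -> A,
    a = \sum_(i < size g) c i ^+ p * g`_i.

Definition fin_gen_algebra (A : comNzRingType) (R : comAlgType A) : Prop :=
  exists s : seq R, forall B : {pred R},
    subalg_closed B -> {subset s <= B} -> forall r, r \in B.

Definition commr (R : comNzRingType) (d : R -> R) (r : R) : R -> R :=
  fun x => d (r * x) - r * d x.

Fixpoint diff_order (R : comNzRingType) (n : nat) (d : R -> R) : Prop :=
  if n is n'.+1 then
    {morph d : x y / x + y} /\ forall r, diff_order n' (commr d r)
  else exists r, d = *%R r.

Section DiffOrder.
Variable R : comNzRingType.
Implicit Types (d e : R -> R) (r : R).

Lemma diff_order_add n d : diff_order n d -> {morph d : x y / x + y}.
Proof. by case: n => [[r ->] x y|n []//]; rewrite mulrDr. Qed.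

Lemma diff_order0 n : diff_order n (fun=> 0 : R).
Proof.
elim: n => [|n IH]; first by exists 0; apply/funext => x; rewrite mul0r.
split=> [x y|r]; first by rewrite addr0.
by have -> : commr (fun=> 0) r = fun=> 0 by apply/funext => x; rewrite /commr; ring.
Qed.

Lemma diff_orderS n d : diff_order n d -> diff_order n.+1 d.
Proof.
elim: n d => [|n IH] d.
  case=> c ->; split=> [x y|r]; first by rewrite mulrDr.
  by exists 0; apply/funext => x; rewrite /commr; ring.
by move=> [dD dc]; split=> // r; apply/IH/dc.
Qed.

Lemma diff_order_le m n d : (m <= n)%N -> diff_order m d -> diff_order n d.
Proof.
move=> /subnKC <-; elim: (n - m)%N => [|k IH] h; first by rewrite addn0.
by rewrite addnS; apply/diff_orderS/IH.
Qed.

Lemma diff_orderD n d e :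
  diff_order n d -> diff_order n e -> diff_order n (fun x => d x + e x).
Proof.
elim: n d e => [|n IH] d e.
  by move=> [a ->] [b ->]; exists (a + b); apply/funext => x; rewrite mulrDl.
move=> [dD dc] [eD ec]; split=> [x y|r]; first by rewrite dD eD; ring.
rewrite (_ : commr _ _ = fun x => commr d r x + commr e r x);
  first by apply: IH; [apply: dc | apply: ec].
by apply/funext => x; rewrite /commr; ring.
Qed.

Lemma diff_orderMl n d c : diff_order n d -> diff_order n (fun x => c * d x).
Proof.
elim: n d => [|n IH] d.
  by move=> [a ->]; exists (c * a); apply/funext => x; rewrite mulrA.
move=> [dD dc]; split=> [x y|r]; first by rewrite dD mulrDr.
rewrite (_ : commr _ _ = fun x => c * commr d r x);
  first by apply: IH; apply: dc.
by apply/funext => x; rewrite /commr; ring.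
Qed.

Lemma diff_orderMr n d c : diff_order n d -> diff_order n (fun x => d (c * x)).
Proof.
elim: n d => [|n IH] d.
  by move=> [a ->]; exists (a * c); apply/funext => x; rewrite mulrA.
move=> [dD dc]; split=> [x y|r]; first by rewrite mulrDr dD.
rewrite (_ : commr _ _ = fun x => commr d r (c * x));
  first by apply: IH; apply: dc.
by apply/funext => x; rewrite /commr mulrCA.
Qed.

Lemma diff_orderN n d : diff_order n d -> diff_order n (fun x => - d x).
Proof.
move=> /(diff_orderMl (-1)); congr (diff_order n _).
by apply/funext => x; rewrite mulN1r.
Qed.

Lemma diff_orderM m n d e :
  diff_order m d -> diff_order n e -> diff_order (m + n) (d \o e).
Proof.
elim: m n d e => [|m IHm] n d e.
  by move=> [c ->] he; rewrite add0n; apply: diff_orderMl.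
elim: n e => [|n IHn] e hd.
  by move=> [c ->]; rewrite addn0; apply: diff_orderMr.
move=> he; have [dD dc] := hd; have [eD ec] := he.
rewrite addnS; split=> [x y|r]; first by rewrite /= eD dD.
rewrite (_ : commr _ _ = fun x => (d \o commr e r) x + (commr d r \o e) x).
  apply: diff_orderD; first by apply: IHn => //; apply: ec.
  by rewrite addSn -addnS; apply: IHm => //; apply: dc.
apply/funext => x; rewrite /commr /=.
have -> : d (e (r * x)) = d (e (r * x) - r * e x) + d (r * e x).
  by rewrite -dD; congr d; ring.
by ring.
Qed.

End DiffOrder.

Record diffop (R : comNzRingType) := DiffOp {
  diffop_fun :> R -> R;
  diffop_subproof : exists n, diff_order n diffop_fun }.

Section DiffOpRing.
Variable R : comNzRingType.
Implicit Types (d e : diffop R).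

HB.instance Definition _ := gen_eqMixin (diffop R).
HB.instance Definition _ := gen_choiceMixin (diffop R).

Lemma diffopP d e : d =1 e -> d = e.
Proof.
case: d e => [d dP] [e eP] /= /funext de; move: dP eP; rewrite de => dP eP.
by rewrite (Prop_irrelevance dP eP).
Qed.

Lemma diffop_morphD d : {morph d : x y / x + y}.
Proof. by have [n /diff_order_add] := diffop_subproof d. Qed.

Fact diffop_mulr_subproof (r : R) : exists n, diff_order n ( *%R r).
Proof. by exists 0%N, r. Qed.
Definition diffop_mulr r := DiffOp (diffop_mulr_subproof r).

Definition diffop_zero := diffop_mulr 0.
Definition diffop_one := diffop_mulr 1.

Fact diffop_opp_subproof d : exists n, diff_order n (fun x => - d x).
Proof.
by have [n h] := diffop_subproof d; exists n; apply: diff_orderN.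
Qed.
Definition diffop_opp d := DiffOp (diffop_opp_subproof d).

Fact diffop_add_subproof d e : exists n, diff_order n (fun x => d x + e x).
Proof.
have [m hd] := diffop_subproof d; have [n he] := diffop_subproof e.
exists (m + n)%N; apply: diff_orderD.
  by apply: diff_order_le hd; rewrite leq_addr.
by apply: diff_order_le he; rewrite leq_addl.
Qed.
Definition diffop_add d e := DiffOp (diffop_add_subproof d e).

Fact diffop_mul_subproof d e : exists n, diff_order n (d \o e).
Proof.
have [m hd] := diffop_subproof d; have [n he] := diffop_subproof e.
by exists (m + n)%N; apply: diff_orderM.
Qed.
Definition diffop_mul d e := DiffOp (diffop_mul_subproof d e).

Fact diffop_addA : associative diffop_add.
Proof. by move=> a b c; apply: diffopP => x /=; rewrite addrA. Qed.
Fact diffop_addC : commutative diffop_add.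
Proof. by move=> a b; apply: diffopP => x /=; rewrite addrC. Qed.
Fact diffop_add0 : left_id diffop_zero diffop_add.
Proof. by move=> a; apply: diffopP => x /=; rewrite mul0r add0r. Qed.
Fact diffop_addN : left_inverse diffop_zero diffop_opp diffop_add.
Proof. by move=> a; apply: diffopP => x /=; rewrite mul0r addNr. Qed.

HB.instance Definition _ := GRing.isZmodule.Build (diffop R)
  diffop_addA diffop_addC diffop_add0 diffop_addN.

Fact diffop_mulA : associative diffop_mul.
Proof. by move=> a b c; apply: diffopP. Qed.
Fact diffop_mul1l : left_id diffop_one diffop_mul.
Proof. by move=> a; apply: diffopP => x /=; rewrite mul1r. Qed.
Fact diffop_mul1r : right_id diffop_one diffop_mul.
Proof. by move=> a; apply: diffopP => x /=; rewrite mul1r. Qed.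
Fact diffop_mulDl : left_distributive diffop_mul diffop_add.
Proof. by move=> a b c; apply: diffopP. Qed.
Fact diffop_mulDr : right_distributive diffop_mul diffop_add.
Proof. by move=> a b c; apply: diffopP => x /=; rewrite diffop_morphD. Qed.

HB.instance Definition _ := GRing.Zmodule_isPzRing.Build (diffop R)
  diffop_mulA diffop_mul1l diffop_mul1r diffop_mulDl diffop_mulDr.

Lemma diffop_addE d e x : (d + e) x = d x + e x. Proof. by []. Qed.
Lemma diffop_mulE d e x : (d * e) x = d (e x). Proof. by []. Qed.

End DiffOpRing.

Section LocDModule.
Variables (R : comNzRingType) (S : mulrClosed R).
Local Notation L := (loc S).
Local Notation iota := (@toloc R S).
Implicit Types (d e : R -> R) (g h : L -> L).

Definition lcommr g (r : R) : L -> L := fun x => g (iota r * x) - iota r * g x.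

(* g is the extension, of order <= n, of d along iota *)
Fixpoint ext_order (n : nat) d g : Prop :=
  if n is n'.+1 then
    [/\ {morph d : x y / x + y}, {morph g : x y / x + y},
        forall r, g (iota r) = iota (d r)
      & forall r, ext_order n' (commr d r) (lcommr g r)]
  else exists2 r, d = *%R r & g = *%R (iota r).

Lemma ext_order_add n d g : ext_order n d g -> {morph g : x y / x + y}.
Proof. by case: n => [[r _ ->] x y|n []//]; rewrite mulrDr. Qed.

Lemma ext_order_iota n d g : ext_order n d g -> forall r, g (iota r) = iota (d r).
Proof. by case: n => [[c -> ->] r|n []//]; rewrite rmorphM. Qed.

Lemma ext_orderS n d g : ext_order n d g -> ext_order n.+1 d g.
Proof.
elim: n d g => [|n IH] d g.
  case=> c -> ->; split=> [x y|x y|r|r]; [by rewrite mulrDr|by rewrite mulrDr|by rewrite rmorphM|].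
  exists 0; first by apply/funext => x; rewrite /commr; ring.
  by apply/funext => x; rewrite /lcommr rmorph0; ring.
by move=> [dD gD gi gc]; split=> // r; apply/IH/gc.
Qed.

Lemma ext_order_le m n d g : (m <= n)%N -> ext_order m d g -> ext_order n d g.
Proof.
move=> /subnKC <-; elim: (n - m)%N => [|k IH] hg; first by rewrite addn0.
by rewrite addnS; apply/ext_orderS/IH.
Qed.

Lemma ext_order_uniq n d g h : ext_order n d g -> ext_order n d h -> g = h.
Proof.
elim: n d g h => [|n IH] d g h.
  move=> [a ea ->] [b eb ->]; congr ( *%R (iota _)).
  by rewrite -[a]mulr1 -[b]mulr1 -[a * 1]/( *%R a 1) -ea eb.
move=> [_ _ gi gc] [_ _ hi hc]; apply/funext; elim/locfrac_ind => r s.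
apply: (@toloc_injl _ _ s).
have := congr1 (fun k => k (locfrac r s)) (IH _ _ _ (gc (denom_val s)) (hc (denom_val s))).
by rewrite /lcommr toloc_frac gi hi => /addrI/oppr_inj.
Qed.

Lemma ext_order_uniq2 m n d g h : ext_order m d g -> ext_order n d h -> g = h.
Proof.
move=> eg eh; apply: (@ext_order_uniq (m + n) d).
  by apply: ext_order_le eg; rewrite leq_addr.
by apply: ext_order_le eh; rewrite leq_addl.
Qed.

Lemma ext_orderD n d e g h : ext_order n d g -> ext_order n e h ->
  ext_order n (fun x => d x + e x) (fun x => g x + h x).
Proof.
elim: n d e g h => [|n IH] d e g h.
  move=> [a -> ->] [b -> ->].
  by exists (a + b); apply/funext => x; rewrite ?rmorphD mulrDl.
move=> [dD gD gi gc] [eD hD hi hc]; split=> [x y|x y|r|r]; [by rewrite dD eD; ring|by rewrite gD hD; ring| |].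
  by rewrite gi hi rmorphD.
have := IH _ _ _ _ (gc r) (hc r).
by congr ext_order; apply/funext => x; rewrite /commr /lcommr; ring.
Qed.

Lemma ext_orderMl n d g c : ext_order n d g ->
  ext_order n (fun x => c * d x) (fun x => iota c * g x).
Proof.
elim: n d g => [|n IH] d g.
  move=> [a -> ->].
  by exists (c * a); apply/funext => x; rewrite ?rmorphM mulrA.
move=> [dD gD gi gc]; split=> [x y|x y|r|r]; [by rewrite dD mulrDr|by rewrite gD mulrDr| |].
  by rewrite gi rmorphM.
have := IH _ _ (gc r).
by congr ext_order; apply/funext => x; rewrite /commr /lcommr; ring.
Qed.

Lemma ext_orderMr n d g c : ext_order n d g ->
  ext_order n (fun x => d (c * x)) (fun x => g (iota c * x)).
Proof.
elim: n d g => [|n IH] d g.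
  move=> [a -> ->].
  by exists (a * c); apply/funext => x; rewrite ?rmorphM mulrA.
move=> [dD gD gi gc]; split=> [x y|x y|r|r]; [by rewrite mulrDr dD|by rewrite mulrDr gD| |].
  by rewrite -rmorphM gi.
have := IH _ _ (gc r).
by congr ext_order; apply/funext => x; rewrite /commr /lcommr mulrCA.
Qed.

Lemma ext_orderN n d g : ext_order n d g ->
  ext_order n (fun x => - d x) (fun x => - g x).
Proof.
move=> /(ext_orderMl (-1)); congr ext_order; apply/funext => x.
  by rewrite mulN1r.
by rewrite rmorphN1 mulN1r.
Qed.

Lemma ext_orderM m n d e g h : ext_order m d g -> ext_order n e h ->
  ext_order (m + n) (d \o e) (g \o h).
Proof.
elim: m n d e g h => [|m IHm] n d e g h.
  by move=> [c -> ->] he; rewrite add0n; apply: ext_orderMl.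
elim: n e h => [|n IHn] e h hg.
  by move=> [c -> ->]; rewrite addn0; apply: ext_orderMr.
move=> hh; have [dD gD gi gc] := hg; have [eD hD hi hc] := hh.
rewrite addnS; split=> [x y|x y|r|r]; rewrite /=;
  [by rewrite eD dD|by rewrite hD gD|by rewrite hi gi|].
have -> : commr (d \o e) r = fun x => (d \o commr e r) x + (commr d r \o e) x.
  apply/funext => x; rewrite /commr /=.
  have -> : d (e (r * x)) = d (e (r * x) - r * e x) + d (r * e x).
    by rewrite -dD; congr d; ring.
  by ring.
have -> : lcommr (g \o h) r = fun x => (g \o lcommr h r) x + (lcommr g r \o h) x.
  apply/funext => x; rewrite /lcommr /=.
  have -> : g (h (iota r * x)) =
            g (h (iota r * x) - iota r * h x) + g (iota r * h x).
    by rewrite -gD; congr g; ring.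
  by ring.
have h1 : ext_order (m.+1 + n) (d \o commr e r) (g \o lcommr h r).
  exact: IHn hg (hc r).
have h2 : ext_order (m.+1 + n) (commr d r \o e) (lcommr g r \o h).
  by rewrite addSn -addnS; apply: IHm (gc r) hh.
exact: ext_orderD h1 h2.
Qed.

Lemma ext_order_exists n d : diff_order n d -> exists g, ext_order n d g.
Proof.
elim: n d => [|n IH] d; first by move=> [r ->]; exists ( *%R (iota r)), r.
move=> [dD dc].
have [D DP] := choice (fun r => IH _ (dc r)).
have DD r : {morph D r : x y / x + y} := ext_order_add (DP r).
have Di r a : D r (iota a) = iota (commr d r a) := ext_order_iota (DP r) a.
have DM t s : D (t * s) = fun x => D t (iota s * x) + iota t * D s x.
  apply: ext_order_uniq (DP _) _.
  have := ext_orderD (ext_orderMr s (DP t)) (ext_orderMl t (DP s)).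
  by congr ext_order; apply/funext => x; rewrite /commr mulrA; ring.
have DC r s : lcommr (D s) r = lcommr (D r) s.
  have [_ _ _ h1] := ext_orderS (DP s); have [_ _ _ h2] := ext_orderS (DP r).
  apply: ext_order_uniq (h1 r) _; have := h2 s.
  congr ext_order; apply/funext => x; rewrite /commr.
  by rewrite [s * (r * x)]mulrCA; ring.
(* y is an admissible value of the extension at x = r / s *)
pose W (r s : R) x y := iota s * y = iota (d r) - D s x.
have WM t r s x y : iota s * x = iota r -> W r s x y -> W (t * r) (t * s) x y.
  rewrite /W DM => -> e; rewrite Di /commr rmorphB !rmorphM -mulrA e.
  by ring.
pose g x := locfrac 1 (loc_den x) *
  (iota (d (loc_num x)) - D (denom_val (loc_den x)) x).
have gW r s : W r (denom_val s) (locfrac r s) (g (locfrac r s)).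
  set x := locfrac r s.
  have /locfrac_eq[t tS e] := loc_numden x.
  have xe : iota (denom_val (loc_den x)) * x = iota (loc_num x).
    by rewrite -{2}[x]loc_numden toloc_frac.
  have W1 : W (loc_num x) (denom_val (loc_den x)) x (g x).
    by rewrite /W /g mulrA toloc_inv mul1r.
  have := WM (t * denom_val s) _ _ _ _ xe W1.
  pose y := locfrac 1 s * (iota (d r) - D (denom_val s) x).
  have W2 : W r (denom_val s) x y by rewrite /W /y mulrA toloc_inv mul1r.
  have := WM (t * denom_val (loc_den x)) _ _ _ _ (toloc_frac r s) W2.
  rewrite (_ : t * denom_val (loc_den x) * r = t * denom_val s * loc_num x); last first.
    transitivity (t * (r * denom_val (loc_den x))); first by ring.
    by rewrite -e; ring.
  rewrite [t * _ * denom_val s]mulrAC /W => <- h.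
  suff <- : y = g x by [].
  apply: (@toloc_injl _ _ (denomM (denomM (Denom tS) s) (loc_den x))).
  by rewrite h.
have gD : {morph g : x y / x + y}.
  elim/locfrac_ind=> a s; elim/locfrac_ind=> b t.
  apply: (@toloc_injl _ _ (denomM s t)); rewrite mulrDr [denom_val _]/=.
  rewrite {1}addlE (gW _ (denomM s t)) -addlE /=.
  have := WM (denom_val t) _ _ _ _ (toloc_frac a s) (gW a s).
  rewrite [denom_val t * denom_val s]mulrC => ->.
  rewrite (WM (denom_val s) _ _ _ _ (toloc_frac b t) (gW b t)).
  rewrite DD dD [a * _]mulrC [b * _]mulrC rmorphD.
  by ring.
have gi r : g (iota r) = iota (d r).
  have := gW r (denom1 S); rewrite /W rmorph1 mul1r -/(iota r) => ->.
  by rewrite Di /commr !mul1r subrr rmorph0 subr0.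
exists g; split=> // r.
suff -> : lcommr g r = D r by [].
apply/funext; elim/locfrac_ind=> a s; apply: (@toloc_injl _ _ s).
set x := locfrac a s.
have e1 : iota r * x = locfrac (r * a) s.
  by rewrite mullE; apply/locfrac_eq; exists 1; rewrite ?rpred1 //=; ring.
have e2 : iota (denom_val s) * g (iota r * x) =
          iota (d (r * a)) - D (denom_val s) (iota r * x).
  by rewrite e1; apply: gW.
have e3 : iota (denom_val s) * g x = iota (d a) - D (denom_val s) x := gW a s.
have := congr1 (fun k => k x) (DC r (denom_val s)).
rewrite /lcommr toloc_frac Di /commr => e4.
rewrite mulrBr e2 mulrCA e3.
have -> : iota (denom_val s) * D r x = iota (d (r * a) - r * d a) -
  (D (denom_val s) (iota r * x) - iota r * D (denom_val s) x) by rewrite e4; ring.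
by rewrite rmorphB rmorphM; ring.
Qed.

Lemma loc_dscale_exists (d : diffop R) : exists g, exists n, ext_order n d g.
Proof.
have [n hd] := diffop_subproof d; have [g hg] := ext_order_exists hd.
by exists g, n.
Qed.

(* Well defined because extensions are unique: see [ext_order_uniq2]. *)
Definition loc_dscale (d : diffop R) : L -> L := sval (cid (loc_dscale_exists d)).

Lemma loc_dscaleP (d : diffop R) : exists n, ext_order n d (loc_dscale d).
Proof. exact: svalP (cid (loc_dscale_exists d)). Qed.

Lemma loc_dscale_eq n (d : diffop R) g : ext_order n d g -> loc_dscale d = g.
Proof. by have [m h] := loc_dscaleP d => /(ext_order_uniq2 h). Qed.

Fact loc_dscaleA (d e : diffop R) x :
  loc_dscale d (loc_dscale e x) = loc_dscale (d * e) x.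
Proof.
have [m hd] := loc_dscaleP d; have [n he] := loc_dscaleP e.
by rewrite (@loc_dscale_eq (m + n) (d * e) _ (ext_orderM hd he)).
Qed.

Fact loc_dscale1 : left_id 1 loc_dscale.
Proof.
move=> x; rewrite (@loc_dscale_eq 0 _ ( *%R (iota 1))) ?rmorph1 ?mul1r //.
by exists 1; rewrite ?rmorph1.
Qed.

Fact loc_dscaleDr : right_distributive loc_dscale +%R.
Proof. by move=> d x y; have [n /ext_order_add->] := loc_dscaleP d. Qed.

Fact loc_dscaleDl x : {morph loc_dscale^~ x : d e / d + e}.
Proof.
move=> d e; have [m hd] := loc_dscaleP d; have [n he] := loc_dscaleP e.
have hd' := ext_order_le (leq_addr n m) hd.
have he' := ext_order_le (leq_addl m n) he.
by rewrite (@loc_dscale_eq (m + n) (d + e) _ (ext_orderD hd' he')).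
Qed.

HB.instance Definition _ := GRing.Zmodule_isLmodule.Build (diffop R) L
  loc_dscaleA loc_dscale1 loc_dscaleDr loc_dscaleDl.

(* This module structure extends the R-module structure of the localization,  *)
(* it makes toloc linear over D_R, and it is the only one with these two      *)
(* properties.                                                                *)
Lemma loc_scale_mulr (r : R) (x : L) : diffop_mulr r *: x = iota r * x.
Proof.
have h : ext_order 0 (diffop_mulr r) ( *%R (iota r)) by exists r.
by rewrite -(loc_dscale_eq h).
Qed.

Lemma loc_scale_toloc (d : diffop R) (r : R) : d *: iota r = iota (d r).
Proof. by have [n /ext_order_iota] := loc_dscaleP d; apply. Qed.

Lemma loc_scale_uniq (act : diffop R -> L -> L) :
    (forall (d : diffop R) x y, act d (x + y) = act d x + act d y) ->
    (forall (d e : diffop R) x, act (d + e) x = act d x + act e x) ->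
    (forall (d e : diffop R) x, act (d * e) x = act d (act e x)) ->
    (forall r x, act (diffop_mulr r) x = iota r * x) ->
    (forall (d : diffop R) r, act d (iota r) = iota (d r)) ->
  forall (d : diffop R) x, act d x = d *: x.
Proof.
move=> actDr actDl actM actr acti d x; have [n hd] := diffop_subproof d.
suff /loc_dscale_eq e : ext_order n d (act d) by rewrite -e.
elim: n d hd => [|n IH] d /=.
  move=> [r dr]; exists r => //; apply/funext => y; rewrite -actr.
  by congr act; apply: diffopP => z /=; rewrite dr.
move=> [dD dc]; split=> // r.
pose c := d * diffop_mulr r - diffop_mulr r * d.
have ec : diffop_fun c = commr d r by [].
have -> : lcommr (act d) r = act c.
  apply/funext => y; rewrite /lcommr -!actr -!actM.
  apply/eqP; rewrite subr_eq -actDl; apply/eqP; congr act.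
  by rewrite /c subrK.
by rewrite -ec; apply: IH; rewrite ec.
Qed.

End LocDModule.

Definition generated_by (D : pzRingType) (M : lmodType D) (v : M) : Prop :=
  forall x : M, exists d : D, x = d *: v.

(* Main.v *)
(* Since R is regular and F-finite, it has a dual basis over its subring of
   p-th powers (Kunz). Locally this holds because a system of parameters x of a
   regular local ring stays regular after raising its members to p-th powers:
   then the coefficients of a relation between minimal generators over the p-th
   powers lie successively in (x_1, ..., x_d), ..., (x_1), 0.

   Let J_e be the ideal of all phi(f^(p^e - 1)), phi additive and p^-e-linear.
   The J_e form a descending chain with x J_{m+1} <= J_{n+1} whenever
   x^p J_m <= J_n, and Gabber's argument shows that such a chain is stationary:
   if x kills J_n / J_{n+1} then x^2 kills J_n / J_{n+k} for all k, and at a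
   minimal prime of the common annihilator the chain has finite length.

   If J_e = J_{e+k}, expanding f^(p^e - 1) in a dual basis and raising it to the
   power p^k yields an R^q-linear map d, q = p^(e+k), which sends f^(q - 1) to
   f^(q - p^k). In characteristic p such a map is a differential operator, and
   it sends 1/f to 1/f^(p^k). *)

From HB Require Import structures.
Require Import Defs.
From mathcomp Require Import all_boot all_order all_algebra.
From mathcomp Require Import ring zify.
From mathcomp Require Import boolp classical_sets.

Set Implicit Arguments.
Unset Strict Implicit.
Unset Printing Implicit Defensive.

Import GRing.Theory.
Local Open Scope classical_set_scope.
Local Open Scope ring_scope.

(** * Ideals *)

Section Ideals.
Variable R : comNzRingType.
Implicit Types (I J K L M N P C : set R) (s t : seq R) (x y z a c : R).

Definition ideal I :=
  [/\ I 0, forall x y, I x -> I y -> I (x + y) & forall c x, I x -> I (c * x)].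

Definition prime_set P := forall x y, P (x * y) -> P x \/ P y.

Section IdealClosure.
Variables (I : set R) (hI : ideal I).

Lemma ideal0 : I 0. Proof. by case: hI. Qed.
Lemma idealD x y : I x -> I y -> I (x + y). Proof. by case: hI => _ h _; apply: h. Qed.
Lemma idealM c x : I x -> I (c * x). Proof. by case: hI => _ _ h; apply: h. Qed.
Lemma idealMC c x : I x -> I (x * c). Proof. by rewrite mulrC; apply: idealM. Qed.
Lemma idealN x : I x -> I (- x).
Proof. by move=> ?; rewrite -mulN1r; apply: idealM. Qed.
Lemma idealB x y : I x -> I y -> I (x - y).
Proof. by move=> ? ?; apply: idealD => //; apply: idealN. Qed.
Lemma ideal_eqB x y : I (x - y) -> I y -> I x.
Proof. by move=> ? ?; rewrite -(subrK y x); apply: idealD. Qed.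
Lemma ideal1 x : I 1 -> I x.
Proof. by move=> ?; rewrite -(mulr1 x); apply: idealM. Qed.
Lemma ideal_sum (T : Type) (r : seq T) (Q : pred T) (F : T -> R) :
  (forall i, Q i -> I (F i)) -> I (\sum_(i <- r | Q i) F i).
Proof. by move=> h; elim/big_ind: _ => //; [exact: ideal0|exact: idealD]. Qed.

Lemma prime_exp x n : prime_set I -> ~ I 1 -> I (x ^+ n) -> I x.
Proof.
move=> pI I1; elim: n => [|n IH]; first by rewrite expr0.
by rewrite exprS => /pI [].
Qed.
End IdealClosure.

(** The ideal I + J; the summand from I is kept as the difference [z - y], so that only one witness
    is needed. *)
Definition ideal_add I J := [set z | exists2 y, J y & I (z - y)].
Definition principal a := [set z | exists c, z = c * a].

Lemma idealT : ideal setT. Proof. by []. Qed.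

Lemma ideal_zero : ideal [set 0].
Proof.
by split=> // [x y -> ->|c x ->] /=; rewrite ?addr0 ?mulr0.
Qed.

Lemma ideal_setI I J : ideal I -> ideal J -> ideal (I `&` J).
Proof.
move=> hI hJ; split; first by split; exact: ideal0.
  by move=> x y [? ?] [? ?]; split; exact: idealD.
by move=> c x [? ?]; split; exact: idealM.
Qed.

Lemma ideal_addP I J : ideal I -> ideal J -> ideal (ideal_add I J).
Proof.
move=> hI hJ; split.
- by exists 0; [exact: ideal0|rewrite subrr; exact: ideal0].
- move=> x y [u Ju Iu] [v Jv Iv]; exists (u + v); first exact: idealD.
  by rewrite opprD addrACA; exact: idealD.
- move=> c x [u Ju Iu]; exists (c * u); first exact: idealM.
  by rewrite -mulrBr; exact: idealM.
Qed.

Lemma ideal_principal a : ideal (principal a).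
Proof.
split; first by exists 0; rewrite mul0r.
  by move=> x y [c ->] [d ->]; exists (c + d); rewrite mulrDl.
by move=> c x [d ->]; exists (c * d); rewrite mulrA.
Qed.

Lemma principal_id a : principal a a. Proof. by exists 1; rewrite mul1r. Qed.

Lemma ideal_addl I J : ideal J -> I `<=` ideal_add I J.
Proof. by move=> hJ x Ix; exists 0; rewrite ?subr0 //; exact: ideal0. Qed.

Lemma ideal_addr I J : ideal I -> J `<=` ideal_add I J.
Proof. by move=> hI x Jx; exists x; rewrite ?subrr //; exact: ideal0. Qed.

Lemma ideal_add_sub I J K : ideal K -> I `<=` K -> J `<=` K -> ideal_add I J `<=` K.
Proof.
by move=> hK IK JK x [y /JK Ky /IK h]; exact: ideal_eqB h Ky.
Qed.

Lemma principal_sub I a : ideal I -> I a -> principal a `<=` I.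
Proof. by move=> hI Ia _ [c ->]; exact: idealM. Qed.

Definition colon I J := [set x | forall y, J y -> I (x * y)].

Lemma ideal_colon I J : ideal I -> ideal (colon I J).
Proof.
move=> hI; split=> [y _|x x' h h' y Jy|c x h y Jy].
- by rewrite mul0r; exact: ideal0.
- by rewrite mulrDl; apply: idealD => //; [exact: h|exact: h'].
- by rewrite -mulrA; apply: idealM => //; exact: h.
Qed.

(** The set [C] of allowed coefficients serves three cases: all of R for generated ideals, a prime P
    for Nakayama's lemma, and the p-th powers for F-finiteness. *)
Fixpoint span_in C s : set R :=
  if s is a :: s' then [set z | exists2 c, C c & span_in C s' (z - c * a)]
  else [set 0].
Notation span := (span_in setT).

Definition subgroup C := C 0 /\ forall x y, C x -> C y -> C (x + y).

Lemma ideal_subgroup I : ideal I -> subgroup I.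
Proof. by move=> hI; split; [exact: ideal0|exact: idealD]. Qed.

Lemma span_in0 C s : subgroup C -> span_in C s 0.
Proof.
by move=> [C0 CD]; elim: s => [|a s IH] //=; exists 0; rewrite ?mul0r ?subrr.
Qed.

Lemma span_inD C s x y : subgroup C ->
  span_in C s x -> span_in C s y -> span_in C s (x + y).
Proof.
move=> [C0 CD]; elim: s x y => [|a s IH] x y /=; first by move=> -> ->; rewrite addr0.
move=> [c Cc h] [d Cd h']; exists (c + d); first exact: CD.
by rewrite mulrDl opprD addrACA; exact: IH.
Qed.

Lemma span_inM C D s d x : (forall c, C c -> D (d * c)) ->
  span_in C s x -> span_in D s (d * x).
Proof.
move=> CD; elim: s x => [|a s IH] x /=; first by move=> ->; rewrite mulr0.
move=> [c Cc h]; exists (d * c); first exact: CD.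
by rewrite -mulrA -mulrBr; exact: IH.
Qed.

Lemma ideal_span_in I s : ideal I -> ideal (span_in I s).
Proof.
move=> hI; have sI := ideal_subgroup hI; split; first exact: span_in0.
  by move=> x y; exact: span_inD.
by move=> c x; apply: span_inM => d; exact: idealM.
Qed.

Lemma ideal_span s : ideal (span s).
Proof. exact: ideal_span_in idealT. Qed.

Lemma span_in_mem C s a c : subgroup C -> a \in s -> C c -> span_in C s (c * a).
Proof.
move=> sC; elim: s => [|b s IH] //=; rewrite inE => /predU1P[-> Cc|/IH h Cc].
  by exists c => //; rewrite subrr; exact: span_in0.
by exists 0; [exact: sC.1|rewrite mul0r subr0; exact: h].
Qed.

Lemma span_mem s a : a \in s -> span s a.
Proof. by move=> h; rewrite -(mul1r a); exact: span_in_mem. Qed.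

Lemma span_in_sub C D s : subgroup D ->
  (forall a c, a \in s -> C c -> D (c * a)) -> span_in C s `<=` D.
Proof.
move=> [D0 DD]; elim: s => [|a s IH] h x /=; first by move=> ->.
move=> [c Cc /IH hx]; rewrite -(subrK (c * a) x); apply: DD.
  by apply: hx => b d bs; apply: h; rewrite inE bs orbT.
by apply: h => //; rewrite inE eqxx.
Qed.

Lemma span_sub I s : ideal I -> {in s, forall a, I a} -> span s `<=` I.
Proof.
move=> hI h; apply: span_in_sub (ideal_subgroup hI) _ => a c /h Ia _.
exact: idealM.
Qed.

Lemma span_inP C s x : span_in C s x <->
  exists c : 'I_(size s) -> R, (forall i, C (c i)) /\ x = \sum_(i < size s) c i * s`_i.
Proof.
elim: s x => [|a s IH] x /=.
  split=> [->|[c [_ ->]]]; last by rewrite big_ord0.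
  by exists (fun=> 0); split; [case=> ? ?|rewrite big_ord0].
split=> [[c Cc /IH[d [Cd e]]]|[c [Cc ->]]].
  exists (fun i => oapp d c (unlift ord0 i)); split.
    by move=> i; case: unliftP => [j|] _ //=.
  rewrite big_ord_recl unlift_none /=; apply/eqP; rewrite addrC -subr_eq e; apply/eqP.
  by apply: eq_bigr => i _; rewrite liftK.
exists (c ord0) => //; apply/IH; exists (c \o lift ord0); split=> [i|]; first exact: Cc.
by rewrite big_ord_recl addrAC subrr add0r.
Qed.

Lemma idealrP I : ideal I -> ~ I 1 -> exists K : idealr R, forall x, x \in K <-> I x.
Proof.
move=> hI I1; pose Ib : {pred R} := fun x => `[<I x>].
have Ibc : idealr_closed Ib.
  split; first by apply/asboolP; exact: ideal0.
    by apply/asboolP.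
  move=> a x y /asboolP hx /asboolP hy; apply/asboolP.
  by apply: idealD => //; exact: idealM.
pose B := isIdealr.Build R Ib Ibc; pose K : idealr R := HB.pack Ib B.
by exists K => x; split=> /asboolP.
Qed.

Lemma prime_idealrP P : ideal P -> ~ P 1 -> prime_set P ->
  exists K : prime_idealr R, forall x, x \in K <-> P x.
Proof.
move=> hI I1 pI; pose Ib : {pred R} := fun x => `[<P x>].
have Ibc : idealr_closed Ib.
  split; first by apply/asboolP; exact: ideal0.
    by apply/asboolP.
  move=> a x y /asboolP hx /asboolP hy; apply/asboolP.
  by apply: idealD => //; exact: idealM.
have Ibp : prime_idealr_closed Ib.
  by move=> x y /asboolP/pI[] h; apply/orP; [left|right]; apply/asboolP.
pose B := isIdealr.Build R Ib Ibc; pose B' := isPrimeIdealrClosed.Build R Ib Ibp.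
pose K : prime_idealr R := HB.pack Ib B B'.
by exists K => x; split=> /asboolP.
Qed.

Lemma ideal_idealr (K : idealr R) : ideal [set x | x \in K].
Proof.
split=> [|x y|c x] /=; first exact: idealr0.
  exact: rpredD.
exact: idealMr.
Qed.

Section Noetherian.
Hypothesis nR : noetherian R.

Lemma noetherian_span I : ideal I -> exists s, I = span s.
Proof.
move=> hI; have [I1|I1] := pselect (I 1).
  exists [:: 1]; apply/seteqP; split=> x _; last exact: ideal1.
  by exists x => //=; rewrite mulr1 subrr.
have [K KP] := idealrP hI I1; have [s sP] := nR K; exists s.
apply/seteqP; split=> x.
  by move=> /KP/sP[c ->]; apply/span_inP; exists c.
by move=> /span_inP[c [_ ->]]; apply/KP/sP; exists c.
Qed.

(** Without a maximal member, choice yields a strictly increasing sequence of ideals; its union is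
    finitely generated, and all generators already occur at some stage. *)
Lemma noetherian_max (F : set (set R)) : (forall I, F I -> ideal I) ->
  (exists I, F I) -> exists2 I, F I & forall J, F J -> I `<=` J -> J `<=` I.
Proof.
move=> Fi [I0 F0]; apply: contrapT => nmax.
have step (u : {I | F I}) : exists v : {I | F I},
    sval u `<=` sval v /\ ~ sval v `<=` sval u.
  case: u => I FI; apply: contrapT => h; apply: nmax; exists I => // J FJ IJ.
  by apply: contrapT => JI; apply: h; exists (exist _ J FJ).
have [nxt nxtP] := choice step.
pose u n := sval (iter n nxt (exist _ I0 F0)).
have uS n : u n `<=` u n.+1 by case: (nxtP (iter n nxt (exist _ I0 F0))).
have uI n : ideal (u n) by apply: Fi; rewrite /u; case: (iter _ _ _).
have ule m n : (m <= n)%N -> u m `<=` u n.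
  move=> /subnKC <-; elim: (n - m)%N => [|k IH]; rewrite ?addn0 ?addnS //.
  exact: subset_trans IH (uS _).
have UI : ideal [set x | exists n, u n x].
  split=> [|x y [m hm] [n hn]|c x [n hn]]; first by exists 0%N; exact: ideal0.
    exists (maxn m n); apply: idealD => //.
      by apply: ule hm; exact: leq_maxl.
    by apply: ule hn; exact: leq_maxr.
  by exists n; exact: idealM.
have [s sP] := noetherian_span UI.
have [n hn] : exists n, {in s, forall a, u n a}.
  have: {in s, forall a, exists n, u n a} by move=> a /span_mem; rewrite -sP.
  elim: s {sP} => [|a s IH] h; first by exists 0%N.
  have [m hm] : exists m, u m a by apply: h; rewrite inE eqxx.
  have [|n hn] := IH; first by move=> b bs; apply: h; rewrite inE bs orbT.
  exists (maxn m n) => b; rewrite inE => /predU1P[->|/hn h'].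
    by apply: ule hm; exact: leq_maxl.
  by apply: ule h'; exact: leq_maxr.
have [_] := nxtP (iter n nxt (exist _ I0 F0)); apply => x hx.
by apply: (span_sub (uI n) hn); rewrite -sP; exists n.+1.
Qed.

End Noetherian.
End Ideals.

Local Notation span := (span_in setT).

(** * Chains of ideals localized at a prime *)

Section LocalAtPrime.
Variables (R : comNzRingType) (P : set R).
Hypotheses (hP : ideal P) (P1 : ~ P 1) (pP : prime_set P).
Implicit Types (I J K L M N : set R) (s : seq R) (x y z a c : R).

Lemma prime_notM x y : ~ P x -> ~ P y -> ~ P (x * y).
Proof. by move=> ? ? /pP[]. Qed.

(** Elimination replaces the determinant trick: the relation for the head a has leading coefficient
    u = t - c outside P, and multiplying the other relations by u removes a from them. *)
Lemma nakayama_span L s t : ideal L -> ~ P t ->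
    {in s, forall g, exists n, span_in P s n /\ L (t * g - n)} ->
  exists u, ~ P u /\ {in s, forall g, L (u * g)}.
Proof.
move=> hL; have sP := ideal_subgroup hP.
elim: s t => [|a s IH] t Pt h; first by exists t.
have [|n [[c Pc hn] La]] := h a; first by rewrite inE eqxx.
pose u := t - c.
have Pu : ~ P u by move=> Pu; apply: Pt; exact: ideal_eqB Pu Pc.
have e0 : L (u * a - (n - c * a)) by congr L: La; rewrite /u; ring.
have [|v [Pv vL]] := IH (u * t) (prime_notM Pu Pt).
  move=> g gs; have [|m [[d Pd hm] Lg]] := h g; first by rewrite inE gs orbT.
  exists (u * (m - d * a) + d * (n - c * a)); split.
    apply: span_inD => //; apply: (span_inM (C := P)) => // e Pe; exact: idealM.
  have -> : u * t * g - (u * (m - d * a) + d * (n - c * a)) =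
    u * (t * g - m) + d * (u * a - (n - c * a)) by ring.
  by apply: idealD => //; exact: idealM.
exists (v * u); split=> [|g]; first exact: prime_notM.
rewrite inE => /predU1P[->|gs]; last by rewrite -mulrA mulrCA; apply: idealM => //; exact: vL.
apply: (ideal_eqB (y := v * (n - c * a)) hL).
  by rewrite -mulrA -mulrBr; exact: idealM.
have sL : subgroup [set x | L (v * x)].
  split=> [|x y] /=; first by rewrite mulr0; exact: ideal0.
  by rewrite mulrDr; exact: idealD.
apply: (span_in_sub sL _ hn) => b d bs _ /=.
by rewrite mulrCA; apply: idealM => //; exact: vL.
Qed.

Section Noetherian.
Hypothesis nR : noetherian R.

(** Localized at P, the hypothesis reads N <= L + x N and the conclusion N <= L. Denominators appear
    as multipliers outside P, so no localized ring is formed. *)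
Lemma nakayama L N x t : ideal L -> ideal N -> P x -> ~ P t ->
    (forall g, N g -> exists2 n, N n & L (t * g - x * n)) ->
  exists2 u, ~ P u & forall g, N g -> L (u * g).
Proof.
move=> hL hN Px Pt h; have [s sN] := noetherian_span nR hN; subst N.
have [|u [Pu uL]] := nakayama_span (s := s) hL Pt.
  move=> g /span_mem/h[n hn Ln]; exists (x * n); split=> //.
  by apply: span_inM hn => c _; exact: idealMC.
exists u => // g hg.
have hu : ideal [set x | L (u * x)].
  split=> [|a b|c a] /=; first by rewrite mulr0; exact: ideal0.
    by rewrite mulrDr; exact: idealD.
  by rewrite mulrCA; exact: idealM.
exact: (span_sub hu uL).
Qed.

Lemma uniform_multiplier N M : ideal N -> ideal M ->
    (forall g, M g -> exists2 t, ~ P t & N (t * g)) ->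
  exists2 t, ~ P t & forall g, M g -> N (t * g).
Proof.
move=> hN hM h; have [s sM] := noetherian_span nR hM.
have {h} : {in s, forall a, exists2 t, ~ P t & N (t * a)}.
  by move=> a /span_mem; rewrite -sM; exact: h.
rewrite sM; elim: s {sM} => [|a s IH] h.
  by exists 1 => // x ->; rewrite mulr0; exact: ideal0.
have [|c Pc Nc] := h a; first by rewrite inE eqxx.
have [|d Pd Nd] := IH; first by move=> b bs; apply: h; rewrite inE bs orbT.
exists (c * d); first exact: prime_notM.
move=> x /= [e _ /Nd hx].
have -> : c * d * x = c * (d * (x - e * a)) + d * e * (c * a) by ring.
by apply: idealD => //; exact: idealM.
Qed.

(* After localization at P, L n.+1 = L n for all large n. *)
Definition loc_stable (L : nat -> set R) := exists n0, forall n, (n0 <= n)%N ->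
  exists2 s, ~ P s & forall x, L n x -> L n.+1 (s * x).

(* The descending chain condition for M / N localized at P. *)
Definition loc_dcc N M := forall L : nat -> set R,
  (forall n, ideal (L n)) -> (forall n, L n.+1 `<=` L n) ->
  (forall n, N `<=` L n) -> (forall n, L n `<=` M) -> loc_stable L.

(** Descending chains in M / N are controlled by their traces on K and their images modulo K; the
    difference left over by the second lies in L n and in K. *)
Lemma loc_dcc_trans N K M : ideal N -> ideal K -> ideal M ->
  N `<=` K -> K `<=` M -> loc_dcc N K -> loc_dcc K M -> loc_dcc N M.
Proof.
move=> hN hK hM NK KM d1 d2 L hL Ld NL LM.
have [||||n1 h1] := d1 (fun n => L n `&` K).
- by move=> n; exact: ideal_setI.
- by move=> n x [/Ld].
- by move=> n x Nx; split; [exact: NL|exact: NK].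
- by move=> n x [].
have [||||n2 h2] := d2 (fun n => ideal_add (L n) K).
- by move=> n; exact: ideal_addP.
- by move=> n x [y Ky /Ld h]; exists y.
- by move=> n; exact: ideal_addr.
- by move=> n; exact: ideal_add_sub.
exists (maxn n1 n2) => n; rewrite geq_max => /andP[/h1[s Ps hs] /h2[t Pt ht]].
exists (s * t); first exact: prime_notM.
move=> x Lx; have [|z Kz Lz] := ht x; first exact: ideal_addl.
have Lz' : L n z.
  have -> : z = t * x - (t * x - z) by ring.
  by apply: idealB => //; [exact: idealM|exact: Ld].
rewrite -mulrA -(subrK z (t * x)) mulrDr; apply: idealD => //; first exact: idealM.
by case: (hs z).
Qed.

Lemma loc_dcc_kill N M (s : R) : ~ P s -> (forall x, M x -> N (s * x)) -> loc_dcc N M.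
Proof.
move=> Ps h L _ _ NL LM; exists 0%N => n _; exists s => // x /LM Mx.
by apply: NL; exact: h.
Qed.

(** The quotient (N + (g)) / N is R / P, which localizes at P to a field, so a chain can drop only
    once. *)
Lemma loc_dcc_step N g : ideal N -> (forall x, N (x * g) <-> P x) ->
  loc_dcc N (ideal_add N (principal g)).
Proof.
move=> hN hg L hL Ld NL LM.
have [[n0 h0]|hall] := pselect (exists n, forall x, L n x -> N x).
  exists n0 => n le_n; exists 1 => // x Lx; rewrite mul1r; apply: NL; apply: (h0).
  move: Lx; rewrite -(subnKC le_n); elim: (n - n0)%N => [|k IH]; first by rewrite addn0.
  by rewrite addnS => /Ld.
(* No [L n] is contained in N, so each contains r g modulo N for some r outside P. *)
exists 0%N => n _.
have [t Pt Lt] : exists2 t, ~ P t & L n.+1 (t * g).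
  apply: contrapT => hn; apply: hall; exists n.+1 => x Lx.
  have [y [r ey] Nxy] := LM _ _ Lx; apply: (ideal_eqB hN Nxy); rewrite ey.
  apply/hg; apply: contrapT => Pr; apply: hn; exists r => //.
  have -> : r * g = x - (x - y) by rewrite ey; ring.
  by apply: idealB => //; exact: NL.
exists t => // x /LM[y [r ey] Nxy].
rewrite -(subrK y x) mulrDr; apply: idealD => //; first by apply: NL; exact: idealM.
by rewrite ey mulrCA; exact: idealM.
Qed.

(** P acts nilpotently on every element of M / N localized at P, which forces finite length there. A
    maximal K for which K / N has the chain condition must agree locally with M: otherwise some g
    with maximal annihilator modulo K has annihilator exactly P, and K can be enlarged by g. *)
Lemma loc_dcc_nilp N M : ideal N -> ideal M -> N `<=` M ->
    (forall y g, P y -> M g -> exists2 s, ~ P s & exists k, N (s * (y ^+ k * g))) ->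
  loc_dcc N M.
Proof.
move=> hN hM NM nil.
have [||K [hK NK KM dK] Kmax] := @noetherian_max _ nR
  [set K | [/\ ideal K, N `<=` K, K `<=` M & loc_dcc N K]].
- by move=> I [].
- exists N; split=> //; apply: (@loc_dcc_kill N N 1) => // x; by rewrite mul1r.
have [[s Ps sM]|noS] := pselect (exists2 s, ~ P s & forall x, M x -> K (s * x)).
  exact: loc_dcc_trans dK (loc_dcc_kill Ps sM).
have [g0 [Mg0 g0P]] : exists g, M g /\ forall c, K (c * g) -> P c.
  apply: contrapT => no; apply: noS; apply: uniform_multiplier => // g Mg.
  apply: contrapT => noc; apply: no; exists g; split=> // c Kc.
  by apply: contrapT => Pc; apply: noc; exists c.
have [||_ [g [Mg gP ->]] gmax] := @noetherian_max _ nR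
  [set I | exists g, [/\ M g, forall c, K (c * g) -> P c & I = [set c | K (c * g)]]].
- move=> _ [g [_ _ ->]]; split=> [|x y|c x] /=.
  + by rewrite mul0r; exact: ideal0.
  + by rewrite mulrDl; exact: idealD.
  + by rewrite -mulrA; exact: idealM.
- by exists [set c | K (c * g0)]; exists g0.
(* If y g stays nonzero in the localization of M / K, its annihilator contains that of g, hence
   equals it by maximality. Applied repeatedly, this contradicts nilpotence when y is in P. *)
have gmul y : (forall c, K (c * (y * g)) -> P c) ->
    forall c, K (c * (y * g)) -> K (c * g).
  move=> hy; apply: (gmax [set c | K (c * (y * g))]).
    by exists (y * g); split=> //; exact: idealM.
  by move=> c /= Kc; rewrite mulrCA; exact: idealM.
have gK y : P y -> K (y * g).
  move=> Py.
  have [s Ps Ks] : exists2 s, ~ P s & K (s * (y * g)).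
    apply: contrapT => no.
    have hy : forall c, K (c * (y * g)) -> P c.
      by move=> c Kc; apply: contrapT => Pc; apply: no; exists c.
    have hyk k : forall c, K (c * (y ^+ k * g)) -> K (c * g).
      elim: k => [|k IH] c; first by rewrite expr0 mul1r.
      by rewrite exprS -mulrA [c * _]mulrA => /IH; rewrite -mulrA => /(gmul _ hy).
    have [s Ps [k Nk]] := nil y g Py Mg.
    by apply/Ps/gP/(hyk k)/NK.
  apply: (gmul s); last by rewrite mulrCA.
  by move=> c; rewrite mulrA => /gP/pP[].
have dg : loc_dcc K (ideal_add K (principal g)).
  by apply: loc_dcc_step => // x; split=> [/gP|/gK].
have Kg : K g.
  apply: (Kmax (ideal_add K (principal g))).
  - have hg := ideal_principal g; have Mpg := principal_sub hM Mg.
    have KKg := ideal_addl (I := K) hg.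
    split; first exact: ideal_addP.
    + exact: subset_trans NK KKg.
    + exact: ideal_add_sub.
    + by apply: loc_dcc_trans dK dg => //; exact: ideal_addP.
  - by apply: ideal_addl; exact: ideal_principal.
  - by apply: ideal_addr => //; exact: principal_id.
by case: P1; apply: gP; rewrite mul1r.
Qed.

End Noetherian.
End LocalAtPrime.

(** * Regular local rings *)

Definition upd (T : eqType) (a : T -> nat) i b : T -> nat :=
  fun j => if j == i then b else a j.

Lemma upd_same (T : eqType) (a : T -> nat) i b : upd a i b i = b.
Proof. by rewrite /upd eqxx. Qed.

Lemma sum_upd (T : finType) (a : T -> nat) i b :
  (b < a i)%N -> (\sum_j upd a i b j < \sum_j a j)%N.
Proof.
move=> lt_b; rewrite (bigD1 i) //= [ltnRHS](bigD1 i) //= upd_same.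
rewrite (eq_bigr a) ?ltn_add2r // => j /negPf ne.
by rewrite /upd ne.
Qed.

(** * Existence of primes and the principal ideal theorem *)

Section Primes.
Variable R : comNzRingType.
Implicit Types (I J K P Q : set R) (s : seq R) (x y z : R).

Definition is_prime P := [/\ ideal P, ~ P 1 & prime_set P].
Definition radical I := [set x | exists n, I (x ^+ n)].

Lemma ideal_radical I : ideal I -> ideal (radical I).
Proof.
move=> hI; split=> [|x y [m hm] [n hn]|c x [n hn]].
- by exists 1%N; rewrite expr1; exact: ideal0.
- exists (m + n)%N; rewrite exprDn; apply: (ideal_sum hI) => i _.
  rewrite -mulr_natr; apply: idealMC => //.
  have [le_n|lt_n] := leqP n i.
    by rewrite -(subnK le_n) exprD mulrA; exact: idealM.
  have le_m : (m <= m + n - i)%N by lia.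
  by rewrite -(subnK le_m) exprD -mulrA; apply: idealM => //; exact: idealMC.
- by exists n; rewrite exprMn; exact: idealM.
Qed.

Section Noetherian.
Hypothesis nR : noetherian R.

(** An ideal maximal among those that contain I and avoid a multiplicative set is prime. *)
Lemma exists_prime_disjoint I (T : set R) : ideal I -> T 1 ->
    (forall x y, T x -> T y -> T (x * y)) -> (forall x, I x -> ~ T x) ->
  exists Q, [/\ is_prime Q, I `<=` Q & forall x, Q x -> ~ T x].
Proof.
move=> hI T1 TM IT.
have [||Q [hQ IQ QT] Qmax] := @noetherian_max _ nR
  [set J | [/\ ideal J, I `<=` J & forall x, J x -> ~ T x]].
- by move=> J [].
- by exists I; split.
exists Q; split=> //; split=> // [Q1|u v Quv]; first exact: QT Q1 T1.
have big w : ~ Q w -> exists2 c, T c & ideal_add Q (principal w) c.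
  move=> Qw; apply: contrapT => no; apply: Qw.
  have hw := ideal_principal w.
  apply: (Qmax (ideal_add Q (principal w))).
  - split; first exact: ideal_addP.
      exact: subset_trans IQ (ideal_addl _).
    by move=> c h Tc; apply: no; exists c.
  - exact: ideal_addl.
  - by apply: ideal_addr => //; exact: principal_id.
apply: contrapT => /not_orP[/big[c Tc [_ [a ->] hc]] /big[d Td [_ [b ->] hd]]].
apply: (QT (c * d)) (TM _ _ Tc Td).
have -> : c * d = (c - a * u) * d + a * u * (d - b * v) + a * b * (u * v) by ring.
apply: idealD => //; last exact: idealM.
by apply: idealD => //; [exact: idealMC|exact: idealM].
Qed.

(* The last clause makes P minimal over I, without localizing at P. *)
Lemma exists_minimal_prime I : ideal I -> ~ I 1 ->
  exists P (s : R), [/\ is_prime P, I `<=` P, ~ P s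
    & forall y, P y -> exists k, I ((s * y) ^+ k)].
Proof.
move=> hI I1; have hr := ideal_radical hI.
have col (s : R) : [set y | radical I (s * y)] = colon (radical I) (principal s).
  apply/seteqP; split=> y /= h; last by rewrite mulrC; exact: h (principal_id s).
  by move=> _ [c ->]; rewrite mulrCA [y * s]mulrC; exact: idealM.
(* A maximal colon ideal (rad I : s), with s outside rad I, is an associated prime of R / rad I. *)
have [||P [s [rs PE]] Pmax] := @noetherian_max _ nR
  [set J | exists s : R, ~ radical I s /\ J = [set y | radical I (s * y)]].
- by move=> _ [s [_ ->]]; rewrite col; exact: ideal_colon.
- by exists [set y | radical I (1 * y)], 1; split=> // -[n]; rewrite expr1n.
have hP : ideal P by rewrite PE col; exact: ideal_colon.
exists P, s; split.
- split=> //; first by rewrite PE /= mulr1.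
  move=> x y Pxy; apply: contrapT => /not_orP[Px Py]; apply: Px.
  apply: (Pmax [set z | radical I (s * y * z)]).
  + by exists (s * y); split=> //; move: Py; rewrite PE.
  + move=> z; rewrite PE /= => h.
    by rewrite mulrAC; exact: idealMC.
  + by move: Pxy; rewrite PE /= -mulrA [y * x]mulrC.
- by move=> x Ix; rewrite PE; exists 1%N; rewrite expr1; exact: idealM.
- rewrite PE => -[n]; rewrite -expr2 -exprM => h; apply: rs.
  by exists (2 * n)%N.
- by move=> y; rewrite PE.
Qed.

(* Krull's principal ideal theorem: modulo P0, a prime P2 of height at least  *)
(* two is not minimal over (x).                                               *)
Lemma exists_prime_between P0 P1 P2 x y : is_prime P0 -> is_prime P1 ->
    is_prime P2 -> P0 `<=` P1 -> P1 `<=` P2 -> P1 y -> ~ P0 y -> P2 x -> ~ P1 x ->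
  exists Q, [/\ is_prime Q, P0 `<=` Q, Q x, Q `<=` P2 & exists2 z, P2 z & ~ Q z].
Proof.
move=> [h0 n0 p0] [h1 n1 p1] [h2 n2 p2] P01 P12 P1y P0y P2x P1x.
pose N := ideal_add P0 (principal x).
have hx := ideal_principal x; have hN : ideal N by exact: ideal_addP.
apply: contrapT => noQ.
(* Otherwise a prime over N that avoids all [s * z ^+ k] would be the required Q. Hence R / N
   localized at P2 has the descending chain condition. *)
have nil z : P2 z -> exists2 s, ~ P2 s & exists k, N (s * z ^+ k).
  move=> P2z; apply: contrapT => no; apply: noQ.
  have [||||Q [[hQ nQ pQ] NQ QT]] :=
    @exists_prime_disjoint N [set c | exists2 s, ~ P2 s & exists k, c = s * z ^+ k].
  - exact: hN.
  - by exists 1 => //; exists 0%N; rewrite mulr1.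
  - move=> _ _ [s Ps [k ->]] [t Pt [l ->]]; exists (s * t); first exact: prime_notM.
    by exists (k + l)%N; rewrite exprD mulrACA.
  - by move=> c Nc [s Ps [k ec]]; apply: no; exists s => //; exists k; rewrite -ec.
  exists Q; split=> //.
  - exact: subset_trans (ideal_addl hx) NQ.
  - by apply: NQ; apply: ideal_addr => //; exact: principal_id.
  - move=> c Qc; apply: contrapT => P2c; apply: (QT c Qc); exists c => //.
    by exists 0%N; rewrite mulr1.
  - exists z => // Qz; apply: (QT z Qz); exists 1 => //.
    by exists 1%N; rewrite mul1r.
(* q n is the preimage of (y ^ n) under localization at P1, modulo P0. *)
pose q n := [set r | exists2 s, ~ P1 s & ideal_add P0 (principal (y ^+ n)) (s * r)].
have hq0 n : ideal (ideal_add P0 (principal (y ^+ n))).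
  by apply: ideal_addP => //; exact: ideal_principal.
have hq n : ideal (q n).
  split=> [|a b [s Ps ha] [t Pt hb]|c a [s Ps ha]].
  - by exists 1 => //; rewrite mulr0; exact: ideal0.
  - exists (s * t); first exact: prime_notM.
    have -> : s * t * (a + b) = t * (s * a) + s * (t * b) by ring.
    by apply: idealD => //; exact: idealM.
  - by exists s => //; rewrite mulrCA; exact: idealM.
have qd n : q n.+1 `<=` q n.
  move=> a [s Ps ha]; exists s => //; apply: ideal_add_sub ha => //.
    by apply: ideal_addl; exact: ideal_principal.
  apply: principal_sub => //; rewrite exprS; apply: idealM => //.
  by apply: ideal_addr => //; exact: principal_id.
have dcc : loc_dcc P2 N setT.
  apply: loc_dcc_nilp => // z g /nil[s Ps [k h]] _; exists s => //; exists k.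
  by rewrite mulrA; exact: idealMC.
have [||||n0' hst] := dcc (fun n => ideal_add (q n) (principal x)).
- by move=> n; exact: ideal_addP.
- by move=> n; apply: ideal_add_sub; [exact: ideal_addP
    |exact: subset_trans (qd n) (ideal_addl hx)|exact: ideal_addr].
- move=> n; apply: ideal_add_sub; first exact: ideal_addP.
    apply: subset_trans (ideal_addl hx) => c P0c; exists 1 => //; rewrite mul1r.
    by apply: ideal_addl => //; exact: ideal_principal.
  exact: ideal_addr.
- by [].
have {hst} [s Ps hst] := hst n0' (leqnn _); set n := n0' in hst.
have [|u Pu hu] := @nakayama _ P2 h2 p2 nR (q n.+1) (q n) x s (hq _) (hq _) P2x Ps.
  move=> g qg; have [|_ [v ->] h] := hst g; first exact: ideal_addl.
  rewrite mulrC in h; exists v; last by rewrite [x * v]mulrC [s * g]mulrC.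
  (* Since x is outside P1, it can be absorbed into the multiplier; so v itself is in [q n], as
     Nakayama's lemma requires. *)
  have [t Pt ht] : q n (v * x).
    have -> : v * x = g * s - (g * s - v * x) by ring.
    by apply: idealB => //; [exact: idealMC|exact: qd].
  exists (t * x); first exact: prime_notM.
  by rewrite -mulrA [x * v]mulrC.
(* Modulo P0, t u y^n = c y^(n+1). Cancelling y^n puts t u - c y in P0, hence t u in P1, although t
   and u are both outside P1. *)
have [|t Pt [_ [c ->] h]] := hu (y ^+ n).
  exists 1 => //; rewrite mul1r; apply: ideal_addr => //; exact: principal_id.
have : P0 (y ^+ n * (t * u - c * y)).
  by congr P0: h; rewrite exprS; ring.
case/p0 => [/(prime_exp p0 n0)//|/P01 h1'].
have : P1 (t * u) by apply: (ideal_eqB h1 h1'); exact: idealM.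
by case/p1 => // /P12.
Qed.

(** * Chains of primes and the primes generated by parameters *)

Definition chain n (u : nat -> set R) :=
  (forall i, (i <= n)%N -> is_prime (u i)) /\
  (forall i, (i < n)%N -> u i `<=` u i.+1 /\ exists2 z, u i.+1 z & ~ u i z).

Lemma chain_extend n u Q : chain n u -> is_prime Q -> u n `<=` Q ->
  (exists2 z, Q z & ~ u n z) -> chain n.+1 (fun i => if (i <= n)%N then u i else Q).
Proof.
move=> [up us] pQ uQ [z Qz uz]; split=> i; first by case: ifP => // /up.
rewrite ltnS; have [->|ne] := eqVneq i n.
  by move=> _; rewrite leqnn ltnn; split=> //; exists z.
move=> le_in; have lt_in : (i < n)%N by rewrite ltn_neqAle ne.
by rewrite le_in lt_in; exact: us.
Qed.

Lemma chain_le n m u : (m <= n)%N -> chain n u -> chain m u.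
Proof.
move=> le_mn [up us]; split=> i h; first by apply: up; exact: leq_trans le_mn.
by apply: us; exact: leq_trans le_mn.
Qed.

(** Membership of x is pushed down the chain: a prime without x is replaced, by the principal ideal
    theorem, by one with x between its two neighbours. Only the first prime has to be given up. *)
Lemma chain_through n u x : chain n.+1 u -> u n.+1 x ->
  exists v, [/\ chain n v, v n = u n.+1, v 0%N x, u 0%N `<=` v 0%N
    & exists2 z, v 0%N z & ~ u 0%N z].
Proof.
elim: n u => [|n IH] u [up us] ux.
  have [u01 u01'] := us 0%N isT.
  by exists (fun=> u 1%N); split=> //; split=> // i _; exact: up.
have [u12 [z u2z u1z]] := us n.+1 (ltnSn _).
have [u1x|u1x] := pselect (u n.+1 x).
  have [|v [cv vn vx uv vz]] := IH u _ u1x; first exact: chain_le (conj up us).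
  exists (fun i => if (i <= n)%N then v i else u n.+2); split=> //.
    apply: chain_extend => //; first exact: up.
      by rewrite vn.
    by exists z; rewrite ?vn.
  by rewrite ltnn.
have [u01 [y u1y u0y]] := us n (ltnW (ltnSn _)).
have [Q [pQ u0Q Qx Qu2 [w u2w Qw]]] := exists_prime_between
  (up n (ltnW (ltnW (ltnSn _)))) (up n.+1 (ltnW (ltnSn _))) (up n.+2 (leqnn _))
  u01 u12 u1y u0y ux u1x.
have cu' : chain n u by apply: chain_le (conj up us); lia.
have [||v [cv vn vx uv vz]] := IH (fun i => if (i <= n)%N then u i else Q).
- apply: chain_extend => //; exists x => // /u01 h; exact: u1x.
- by rewrite ltnn.
exists (fun i => if (i <= n)%N then v i else u n.+2).
rewrite ltnn in vn; split=> //.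
  apply: chain_extend => //; first exact: up.
    by rewrite vn.
  by exists w; rewrite ?vn.
by rewrite ltnn.
Qed.

Lemma span_rcons s a z : span (rcons s a) z -> exists c, span s (z - c * a).
Proof.
move=> h; have [c _ hc] : span (a :: s) z; last by exists c.
apply: span_sub h; first exact: ideal_span.
by move=> b; rewrite mem_rcons; exact: span_mem.
Qed.

Section Local.
Variable m : set R.
Hypotheses (pm : is_prime m) (m_unit : forall x, ~ m x -> exists y, y * x = 1).

(** By induction on [s2], a chain through its head a starts at (s1, a), which is strictly larger
    than [u 0]; so a is not in [u 0]. An element of [u 0] is then c a modulo (s1) with c in [u 0],
    and Nakayama's lemma gives [u 0] = (s1). *)
Lemma chain_span s2 s1 u : chain (size s2) u -> span s1 `<=` u 0%N ->
    u (size s2) = m -> m = span (s1 ++ s2) ->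
  span s1 = u 0%N /\ forall t1 t2, s2 = t1 ++ t2 ->
    is_prime (span (s1 ++ t1)) /\
    forall a t2', t2 = a :: t2' -> ~ span (s1 ++ t1) a.
Proof.
elim: s2 s1 u => [|a s2 IH] s1 u cu s1u um ms /=.
  have -> : span s1 = u 0%N.
    by apply/seteqP; split=> //; rewrite um ms cats0.
  split=> // -[|//] [|//] _; rewrite cats0; split=> //.
  by rewrite -[s1]cats0 -ms.
have [up us] := cu.
have ma : m a.
  by rewrite ms; apply: span_mem; rewrite mem_cat inE eqxx orbT.
have [v [cv vn va uv [z vz uz]]] := chain_through cu (eq_ind_r (@^~ a) ma um).
have pv := cv.1 0%N isT; have [hu nu pu] := up 0%N isT.
have [||||ev IHt] := IH (rcons s1 a) v.
- by [].
- apply: span_sub; first by case: pv.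
  move=> b; rewrite mem_rcons inE => /predU1P[->//|bs].
  by apply/uv/s1u; exact: span_mem.
- by rewrite vn.
- by rewrite cat_rcons.
have ua : ~ u 0%N a.
  move=> ua; apply: uz; move: vz; rewrite -ev; apply: span_sub => // b.
  rewrite mem_rcons inE => /predU1P[->//|bs].
  by apply/s1u; exact: span_mem.
suff e : span s1 = u 0%N.
  split=> // -[|b t1] t2 /=; last by case=> <- /IHt; rewrite cat_rcons.
  by move=> <-; rewrite cats0 e; split=> [|b t2' [<- _]] //; exact: up.
apply/seteqP; split=> // y uy.
have [hm nm qm] := pm.
have [|w mw hw] := @nakayama _ m hm qm nR (span s1) (u 0%N) a 1
    (ideal_span _) hu ma nm.
  move=> g ug; have [c hc] : exists c, span s1 (g - c * a).
    by apply: span_rcons; rewrite ev; exact: uv.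
  exists c; last by rewrite mul1r [a * c]mulrC.
  have : u 0%N (c * a).
    have -> : c * a = g - (g - c * a) by ring.
    by apply: idealB => //; exact: s1u.
  by case/pu.
have [w' ew] := m_unit mw.
rewrite -[y]mul1r -ew -mulrA; apply: idealM; first exact: ideal_span.
exact: hw.
Qed.

(** * Ideals generated by powers of parameters *)

Variables (d : nat) (x : 'I_d -> R) (u : nat -> set R).
Hypotheses (cu : chain d u) (um : u d = m) (mx : m = span [seq x i | i : 'I_d]).

(** Exponent 0 means that the parameter is left out; the generator x_i^0 = 1 is not included. *)
Definition power_ideal (a : 'I_d -> nat) : set R :=
  span [seq x i ^+ a i | i <- enum 'I_d & (0 < a i)%N].

Lemma ideal_power_ideal a : ideal (power_ideal a).
Proof. exact: ideal_span. Qed.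

Lemma power_ideal_mem a i : (0 < a i)%N -> power_ideal a (x i ^+ a i).
Proof.
move=> ai; apply: span_mem; apply: (map_f (fun i => x i ^+ a i)).
by rewrite mem_filter ai mem_enum.
Qed.

Lemma power_ideal_sub a J : ideal J ->
  (forall i, (0 < a i)%N -> J (x i ^+ a i)) -> power_ideal a `<=` J.
Proof.
move=> hJ h; apply: span_sub => // y /mapP[i]; rewrite mem_filter => /andP[ai _] ->.
exact: h.
Qed.

(** [chain_span] allows any order of the parameters: those with exponent 1 come first, and then any
    prescribed omitted one can be next. *)
Lemma power_ideal_prime a : (forall i, a i <= 1)%N ->
  is_prime (power_ideal a) /\ forall i, a i = 0%N -> ~ power_ideal a (x i).
Proof.
move=> a1; pose Z := [seq i <- enum 'I_d | a i == 0%N].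
pose s := [seq i <- enum 'I_d | (0 < a i)%N].
have es : [seq x i ^+ a i | i <- s] = map x s.
  apply/eq_in_map => i; rewrite mem_filter => /andP[ai _].
  have -> : a i = 1%N by apply/eqP; rewrite eqn_leq a1.
  by rewrite expr1.
have key (t : seq 'I_d) : perm_eq t Z -> is_prime (power_ideal a) /\
    forall i t', t = i :: t' -> ~ power_ideal a (x i).
  move=> pt; have pall : perm_eq (s ++ t) (enum 'I_d).
    have eZ : Z = [seq i <- enum 'I_d | predC (fun i : 'I_d => 0 < a i)%N i].
      by apply: eq_filter => i /=; rewrite lt0n negbK.
    apply: (@perm_trans _ (s ++ Z)); first by rewrite perm_cat2l.
    by rewrite eZ perm_filterC.
  have sz : size (map x s ++ map x t) = d.
    by rewrite -map_cat size_map (perm_size pall) size_enum_ord.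
  have [||||_ /(_ (map x s) (map x t) erefl)[pr nx]] :=
    @chain_span (map x s ++ map x t) [::] u.
  - by rewrite sz.
  - by move=> _ ->; apply: ideal0; case: (cu.1 0%N isT).
  - by rewrite sz.
  - rewrite mx cat0s -map_cat; apply/seteqP.
    have ms := perm_mem (perm_map x pall).
    by split; apply: span_sub; [exact: ideal_span| |exact: ideal_span|] => b bs;
      apply: span_mem; rewrite ?ms // -ms.
  rewrite /power_ideal es; split=> // i t' et; apply: (nx _ (map x t')).
  by rewrite et.
split; first by case: (key Z).
move=> i ai; have iZ : i \in Z by rewrite mem_filter ai mem_enum.
have [|_ /(_ i (rem i Z) erefl)//] := key (i :: rem i Z).
by rewrite perm_sym; exact: perm_to_rem.
Qed.

Lemma power_ideal_upd a i z : (0 < a i)%N -> power_ideal a z ->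
  exists w, power_ideal (upd a i 0) (z - x i ^+ a i * w).
Proof.
move=> ai; have hp := ideal_principal (x i ^+ a i).
have h0 := ideal_power_ideal (upd a i 0).
move=> h; suff [_ [w ->] ?] : ideal_add (power_ideal (upd a i 0)) (principal (x i ^+ a i)) z.
  by exists w; rewrite [_ * w]mulrC.
apply: power_ideal_sub h; first exact: ideal_addP.
move=> j aj; have [->|ne] := eqVneq j i; first by apply: ideal_addr => //; exact: principal_id.
apply: ideal_addl => //; have := @power_ideal_mem (upd a i 0) j.
by rewrite /upd (negPf ne); apply.
Qed.

Lemma power_ideal_upd_sub a i b c : (0 < b)%N -> (b <= c)%N ->
  power_ideal (upd a i c) `<=` power_ideal (upd a i b).
Proof.
move=> b0 le_bc; apply: power_ideal_sub; first exact: ideal_power_ideal.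
move=> j; rewrite /upd; case: eqP => [->|/eqP ne] h.
  rewrite -(subnK le_bc) exprD; apply: idealM; first exact: ideal_power_ideal.
  by have := @power_ideal_mem (upd a i b) i; rewrite upd_same; exact.
by have := @power_ideal_mem (upd a i b) j; rewrite /upd (negPf ne); exact.
Qed.

Lemma power_ideal_upd0 a i b : power_ideal (upd a i 0) `<=` power_ideal (upd a i b).
Proof.
apply: power_ideal_sub; first exact: ideal_power_ideal.
move=> j; rewrite /upd; case: eqP => [->//|/eqP ne] h.
by have := @power_ideal_mem (upd a i b) j; rewrite /upd (negPf ne); exact.
Qed.

(** Exponents cut down to 0 or 1, so that [power_ideal (supp a)] is the prime generated by the
    parameters that occur in [a]. *)
Definition supp (a : 'I_d -> nat) : 'I_d -> nat := fun i => (0 < a i)%N.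

(* The only prime associated to (x_i ^ a_i) is (x_i : a_i > 0). *)
Lemma power_ideal_regular a y z :
  ~ power_ideal (supp a) y -> power_ideal a (y * z) -> power_ideal a z.
Proof.
have [n] := ubnP (\sum_j a j)%N; elim: n => // n IH in a y z *; rewrite ltnS => le_n.
have updn b i : (b < a i)%N -> (\sum_j upd a i b j < n)%N.
  by move=> /sum_upd h; exact: leq_trans h le_n.
have supp1 b : (forall i, supp b i <= 1)%N by move=> i; rewrite /supp; case: (0 < _)%N.
have [a1|/existsNP[i /negP]] := pselect (forall i, a i <= 1)%N.
  have -> : supp a = a by apply/funext => i; have := a1 i; rewrite /supp; case: (a i) => [|[]].
  by move=> ya; case: (power_ideal_prime a1) => -[_ _ pa] _ /pa[/ya|].
rewrite -ltnNge => ai ya hyz; set b := (a i).-1.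
have [b0 eai] : (0 < b)%N /\ a i = b.+1 by rewrite /b; lia.
have ea : a = upd a i b.+1 by apply/funext => j; rewrite /upd -eai; case: eqP => [->|].
have es c : (0 < c)%N -> supp (upd a i c) = supp a.
  by move=> c0; apply/funext => j; rewrite /supp /upd; case: eqP => [->|//]; rewrite c0; lia.
have hI := ideal_power_ideal.
(* Lowering the exponent of x_i from b + 1 to b puts z in the larger ideal, so z = x_i^b w modulo
   the other powers. It remains to show that w is divisible by x_i modulo them. *)
have hb : power_ideal (upd a i b) z.
  apply: (IH _ y); rewrite ?es //; first by apply: updn; lia.
  by move: hyz; rewrite {1}ea; apply: power_ideal_upd_sub.
have [|w] := power_ideal_upd (i := i) _ hb; first by rewrite upd_same.
rewrite upd_same.
have -> : upd (upd a i b) i 0 = upd a i 0 by apply/funext => j; rewrite /upd; case: eqP.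
move=> hw.
have hyw : power_ideal a (x i ^+ b * (y * w)).
  have -> : x i ^+ b * (y * w) = y * z - y * (z - x i ^+ b * w) by ring.
  apply: idealB => //; apply: idealM => //.
  by rewrite ea; exact: power_ideal_upd0 hw.
have [|v] := power_ideal_upd (i := i) _ hyw; first by lia.
have -> : x i ^+ b * (y * w) - x i ^+ a i * v = x i ^+ b * (y * w - x i * v).
  by rewrite eai exprS; ring.
move=> hv.
(* Cancel x_i^b modulo the powers of the other parameters, whose prime does not contain x_i. *)
have hv' : power_ideal (upd a i 0) (y * w - x i * v).
  apply: (IH _ (x i ^+ b)) => //; first by apply: updn; lia.
  have [[hs ns ps] nx] := power_ideal_prime (supp1 (upd a i 0)).
  by move=> /(prime_exp ps ns); apply: nx; rewrite /supp upd_same.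
have hx1 : power_ideal (upd a i 1) (x i).
  by have := @power_ideal_mem (upd a i 1) i; rewrite upd_same expr1; exact.
have hw1 : power_ideal (upd a i 1) w.
  apply: (IH _ y); rewrite ?es //; first by apply: updn; lia.
  apply: (ideal_eqB (hI _) (power_ideal_upd0 1%N hv')).
  by rewrite mulrC; exact: idealM.
have [|v'] := power_ideal_upd (i := i) _ hw1; first by rewrite upd_same.
rewrite upd_same expr1.
have -> : upd (upd a i 1) i 0 = upd a i 0 by apply/funext => j; rewrite /upd; case: eqP.
move=> hv1.
have -> : z = (z - x i ^+ b * w) + x i ^+ b * (w - x i * v') + x i ^+ b.+1 * v'.
  by rewrite exprS; ring.
have ha0 := @power_ideal_upd0 a i b.+1; rewrite -ea in ha0.
apply: idealD => //; first apply: idealD => //; first exact: ha0.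
  by apply: idealM => //; exact: ha0.
by rewrite -eai; apply: idealMC => //; apply: power_ideal_mem; lia.
Qed.

End Local.
End Noetherian.
End Primes.

(** * Freeness of a regular local ring over its p-th powers *)

Section RegularLocal.
Variables (R : comNzRingType) (p : nat).
Hypotheses (charR : p \in [pchar R]) (regR : regular_local R).

Lemma char_gt0 : (0 < p)%N.
Proof. exact: prime_gt0 (pcharf_prime charR). Qed.

Lemma frobD (x y : R) : (x + y) ^+ p = x ^+ p + y ^+ p.
Proof. exact: (rmorphD (pFrobenius_aut charR)). Qed.

Lemma frobB (x y : R) : (x - y) ^+ p = x ^+ p - y ^+ p.
Proof. exact: (rmorphB (pFrobenius_aut charR)). Qed.

Definition frob_comb n (g c : 'I_n -> R) : R := \sum_i c i ^+ p * g i.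
Definition frob_gen n (g : 'I_n -> R) := forall x, exists c, x = frob_comb g c.

Lemma frob_combD n (g c c' : 'I_n -> R) :
  frob_comb g c + frob_comb g c' = frob_comb g (fun i => c i + c' i).
Proof. by rewrite -big_split; apply: eq_bigr => i _; rewrite frobD mulrDl. Qed.

Lemma frob_combB n (g c c' : 'I_n -> R) :
  frob_comb g c - frob_comb g c' = frob_comb g (fun i => c i - c' i).
Proof. by rewrite -sumrB; apply: eq_bigr => i _; rewrite frobB mulrBl. Qed.

Lemma frob_combM n (g c : 'I_n -> R) a :
  a ^+ p * frob_comb g c = frob_comb g (fun i => a * c i).
Proof. by rewrite mulr_sumr; apply: eq_bigr => i _; rewrite exprMn mulrA. Qed.

Lemma regular_local_params : exists m : set R, exists d, exists x : 'I_d -> R,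
  exists u, [/\ is_prime m, forall a, ~ m a -> exists b, b * a = 1, chain d u, u d = m
    & m = span [seq x i | i : 'I_d]].
Proof.
have [nR [m [mmax muniq] [d [[P Pchain] _] [s ms]]]] := regR.
have m_unit a : a \notin m -> exists b, b * a = 1.
  move=> ma; apply: contrapT => nu; apply: (negP ma).
  have [||I [hI I1 aI] Imax] := @noetherian_max _ nR
    [set I | [/\ ideal I, ~ I 1 & principal a `<=` I]].
  - by move=> I [].
  - exists (principal a); split=> //; first exact: ideal_principal.
    by move=> [b e]; apply: nu; exists b.
  have [K KI] := idealrP hI I1.
  have Kmax : maximal_ideal K.
    move=> J KJ x; apply/idP/idP; last exact: KJ.
    move=> Jx; apply/KI; apply: (Imax [set x | x \in J]) Jx.
      split; first exact: ideal_idealr.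
        by rewrite /= idealr1.
      by move=> y /aI/KI/KJ.
    by move=> y /KI/KJ.
  by rewrite -(muniq K Kmax); apply/KI/aI/principal_id.
have Pm i x : x \in P i -> x \in m.
  move=> Px; apply: contraT => /m_unit[b e].
  by move: (idealr1 (P i)); rewrite -e idealMr.
have pP i : is_prime [set x | x \in P i].
  split; first exact: ideal_idealr.
    by rewrite /= idealr1.
  by move=> x y /=; rewrite prime_idealrM => /orP.
have pm : is_prime [set x | x \in m].
  split; first exact: ideal_idealr.
    by rewrite /= idealr1.
  move=> x y /= mxy; apply: contrapT => /not_orP[/negP/m_unit[b eb] /negP/m_unit[c ec]].
  by move: (idealr1 m); rewrite -(mulr1 1) -{1}eb -ec mulrACA idealMr.
(* The last prime of the given chain is replaced by m; since every prime lies in m, the inclusions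
   stay strict. *)
exists [set x | x \in m], d, (tnth s), (fun i => [set x | if (i < d)%N then x \in P i else x \in m]).
split=> //.
- by move=> a /negP/m_unit.
- split=> i; first by case: (i < d)%N.
  move=> lt_i; have [PS nPS] := Pchain i lt_i.
  have [z Pz nPz] : exists2 z, z \in P i.+1 & z \notin P i.
    by apply: contrapT => no; apply: nPS => z Pz; apply: contrapT => /negP nPz; apply: no; exists z.
  rewrite lt_i; case: (i.+1 < d)%N; split=> //; first by exists z => //; apply/negP.
    by move=> y /Pm.
  by exists z; [exact: Pm Pz|apply/negP].
- by rewrite ltnn.
- apply/seteqP; split=> x; rewrite [[seq _ | _ : _]]map_tnth_enum.
    by move=> /ms[c ->]; apply/span_inP; exists c.
  by move=> /span_inP[c [_ ->]]; apply/ms; exists c.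
Qed.

(** Freeness is shown for a generating family of least length. *)
Lemma regular_local_frob_basis n0 (g0 : 'I_n0 -> R) : frob_gen g0 ->
  exists n (g : 'I_n -> R), frob_gen g /\
    forall c, frob_comb g c = 0 -> forall i, c i = 0.
Proof.
move=> gen0; have [nR _] := regR; have p0 := char_gt0.
have [m [d [x [u [pm m_unit cu um mx]]]]] := regular_local_params.
have [hm m1 qm] := pm.
have exn : exists n, `[< exists g : 'I_n -> R, frob_gen g >].
  by exists n0; apply/asboolP; exists g0.
have [/= n /asboolP[g gen] nmin] := ex_minnP exn.
exists n, g; split=> // {exn}.
(* A relation with a coefficient outside m would make a generator redundant. *)
have rel0 c : frob_comb g c = 0 -> forall i, m (c i).
  move=> c0 i; apply: contrapT => /m_unit[w wc].
  case: n g gen nmin c i c0 wc => [|n] g gen nmin c i c0 wc; first by case: i wc.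
  suff /nmin : `[< exists g' : 'I_n -> R, frob_gen g' >] by rewrite ltnn.
  apply/asboolP; exists (g \o lift i) => y.
  have [e ->] := gen y.
  exists (fun k => e (lift i k) - e i * w * c (lift i k)).
  have -> : frob_comb g e = frob_comb g (fun k => e k - e i * w * c k).
    rewrite -frob_combB -(frob_combM _ _ (e i * w)).
    by rewrite c0 mulr0 subr0.
  by rewrite /frob_comb (bigD1_ord i) //= -mulrA wc mulr1 subrr expr0n gtn_eqF // mul0r add0r.
(* [A j] gives the ideal of the p-th powers of the first j parameters, and [I j] the prime generated
   by these parameters. The claim descends from j = d to j = 0, where both ideals are zero. *)
pose A j : 'I_d -> nat := fun i => if (i < j)%N then p else 0%N.
pose I j := power_ideal x (supp (A j)).
have claim e : (e <= d)%N -> forall c, power_ideal x (A (d - e)%N) (frob_comb g c) ->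
    forall k, I (d - e)%N (c k).
  elim: e => [_ c hc k|e IH lt_e].
    (* For j = d, the combination can be rewritten with coefficients in m; the difference of the two
       expressions is a relation, so [rel0] applies. *)
    have [d' [d'm ed]] : exists c', (forall k, m (c' k)) /\ frob_comb g c = frob_comb g c'.
      move: hc; apply: (power_ideal_sub (J := [set z | exists c', (forall k, m (c' k)) /\
        z = frob_comb g c'])).
        split=> [|y z [c1 [m1' ->]] [c2 [m2 ->]]|b y [c1 [m1' ->]]].
        + exists (fun=> 0); split=> [_|]; first exact: ideal0.
          by rewrite /frob_comb big1 // => k' _; rewrite expr0n gtn_eqF // mul0r.
        + exists (fun k => c1 k + c2 k); split=> [k'|]; last by rewrite frob_combD.
          exact: idealD.
        + have [f ef] := choice (fun k => gen (b * g k)).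
          exists (fun l => \sum_k c1 k * f k l); split=> [l|].
            by apply: ideal_sum => // k' _; exact: idealMC.
          rewrite mulr_sumr.
          transitivity (\sum_k frob_comb g (fun l => c1 k * f k l)).
            by apply: eq_bigr => k' _; rewrite mulrCA ef frob_combM.
          rewrite exchange_big; apply: eq_bigr => l _; rewrite -mulr_suml; congr (_ * _).
          by apply/esym; exact: (rmorph_sum (pFrobenius_aut charR)).
      move=> i; rewrite /A subn0 ltn_ord => _.
      have [f ef] := gen 1; exists (fun k => x i * f k); split=> [k'|].
        apply: idealMC => //; rewrite mx; apply: span_mem.
        by apply: map_f; rewrite mem_enum.
      by rewrite -frob_combM -ef mulr1.
    have /rel0/(_ k) h : frob_comb g (fun k => c k - d' k) = 0.
      by rewrite -frob_combB ed subrr.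
    have : m (c k) by exact: ideal_eqB h (d'm k).
    rewrite mx /I; apply: span_sub; first exact: ideal_power_ideal.
    move=> _ /mapP[i _ ->]; have := @power_ideal_mem _ _ x (supp (A d)) i.
    by rewrite subn0 /supp /A ltn_ord p0 expr1; exact.
  set j := (d - e.+1)%N in IH *; have lt_j : (j < d)%N by rewrite /j; lia.
  have ej : (d - e)%N = j.+1 by rewrite /j; lia.
  rewrite ej in IH; pose i0 := Ordinal lt_j.
  have Aj0 : upd (A j.+1) i0 0 = A j.
    apply/funext => i; rewrite /upd /A ltnS -val_eqE /= leq_eqVlt.
    by case: eqP => [->|//]; rewrite ltnn.
  have sAj0 : upd (supp (A j.+1)) i0 0 = supp (A j).
    by rewrite -Aj0; apply/funext => i; rewrite /supp /upd; case: eqP.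
  have sA1 k : (forall i, supp (A k) i <= 1)%N.
    by move=> i; rewrite /supp; case: (0 < _)%N.
  have sAi0 : supp (A j) i0 = 0%N by rewrite /supp /A ltnn.
  have [pI nI] := power_ideal_prime nR pm m_unit cu um mx (sA1 j).
  have [hI I1 qI] := pI; have hA := ideal_power_ideal x (A j).
  have hAp : ideal [set z | power_ideal x (A j) (z ^+ p)].
    split=> [|y z|b y] /=; first by rewrite expr0n gtn_eqF //; exact: ideal0.
      by rewrite frobD; exact: idealD.
    by rewrite exprMn; exact: idealM.
  have IA : I j `<=` [set z | power_ideal x (A j) (z ^+ p)].
    apply: power_ideal_sub => // i; rewrite /supp lt0b => Ai /=; rewrite Ai expr1.
    have := power_ideal_mem x Ai; rewrite {2}/A; case: ifP => // lt_ij.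
    by move: Ai; rewrite /A lt_ij.
  move=> c0 hc0 k.
  have hC : ideal [set y | exists2 c, power_ideal x (A j) (frob_comb g c) & c k = y].
    split=> [|_ _ [c hc <-] [c' hc' <-]|b _ [c hc <-]].
    - exists (fun=> 0) => //; rewrite /frob_comb big1; first exact: ideal0.
      by move=> i _; rewrite expr0n gtn_eqF // mul0r.
    - by exists (fun k => c k + c' k) => //; rewrite -frob_combD; exact: idealD.
    - by exists (fun k => b * c k) => //; rewrite -frob_combM; exact: idealM.
  have mx0 : m (x i0) by rewrite mx; apply: span_mem; apply: map_f; rewrite mem_enum.
  (* The k-th coefficients of all combinations in the ideal of [A j] form an ideal C. By induction c
     = x b modulo [I j]; cancelling x^p shows that b is again such a family of coefficients, so C <=
     [I j] + x C. *)
  have [|w mw hw] := @nakayama _ m hm qm nR (I j) _ (x i0) 1 hI hC mx0 m1.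
    move=> _ [c hc <-].
    have hc' : power_ideal x (A j.+1) (frob_comb g c).
      have -> : A j.+1 = upd (A j.+1) i0 p.
        by apply/funext => i; rewrite /upd /A; case: eqP => [->|//]; rewrite /= ltnSn.
      by apply: power_ideal_upd0; rewrite Aj0.
    have dec l : exists b, I j (c l - x i0 * b).
      have [|b] := power_ideal_upd (i := i0) _ (IH (ltnW lt_e) c hc' l).
        by rewrite /supp /A /= ltnSn p0.
      have -> : supp (A j.+1) i0 = 1%N by rewrite /supp /A /= ltnSn p0.
      by rewrite sAj0 expr1; exists b.
    have [b hb] := choice dec.
    exists (b k); last by rewrite mul1r.
    exists b => //.
    apply: (@power_ideal_regular _ nR m pm m_unit d x u cu um mx (A j) (x i0 ^+ p)).
      by move=> /(prime_exp qI I1); exact: nI.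
    rewrite frob_combM -[X in frob_comb g X](_ : (fun i => c i - (c i - x i0 * b i)) = _).
      rewrite -frob_combB; apply: idealB => //; apply: ideal_sum => // i _.
      by apply: idealMC => //; exact: (IA _ (hb i)).
    by apply/funext => i; ring.
  have [w' ew] := m_unit _ mw.
  rewrite -[c0 k]mul1r -ew -mulrA; apply: idealM => //.
  by apply: hw; exists c0.
move=> c c0 k.
have := claim d (leqnn d) c _ k; rewrite subnn c0 => /(_ (ideal0 (ideal_power_ideal _ _))).
by rewrite /I /power_ideal (eq_filter (a2 := pred0)) ?filter_pred0.
Qed.

End RegularLocal.

(** * Dual bases over p-th powers *)

Section LocAt.
Variables (R : comNzRingType) (P : prime_idealr R).
Local Notation S := (loc_at P).

Definition to_loc_at : R -> S := @toloc R (prime_compl P).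
Local Notation iota := to_loc_at.

Lemma to_loc_at_morph : zmod_morphism iota /\ monoid_morphism iota.
Proof. by split; [exact: toloc_zmod_morphism|exact: toloc_monoid_morphism]. Qed.

HB.instance Definition _ :=
  GRing.isZmodMorphism.Build R S iota to_loc_at_morph.1.
HB.instance Definition _ :=
  GRing.isMonoidMorphism.Build R S iota to_loc_at_morph.2.

Lemma loc_at_num (x : S) : exists2 s, s \notin P & exists a, iota s * x = iota a.
Proof.
elim/locfrac_ind: x => a [s sP]; exists s; first exact: sP.
by exists a; exact: (toloc_frac a (Denom sP)).
Qed.

Lemma to_loc_at_unit s : s \notin P -> exists v, v * iota s = 1.
Proof.
move=> sP; have sP' : s \in prime_compl P := sP.
exists (locfrac 1 (Denom sP')); rewrite mulrC.
exact: (toloc_inv (Denom sP')).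
Qed.

Lemma to_loc_at_eq a b : iota a = iota b -> exists2 u, u \notin P & u * a = u * b.
Proof.
by move=> /locfrac_eq[u uP]; rewrite /= !mulr1 => e; exists u.
Qed.

Lemma loc_at_common_denom (T : finType) (y : T -> S) :
  exists2 s, s \notin P & forall t, exists r, iota s * y t = iota r.
Proof.
have {}h : forall t, exists sr : R * R, sr.1 \notin P /\ iota sr.1 * y t = iota sr.2.
  by move=> t; have [s sP [a e]] := loc_at_num (y t); exists (s, a).
have [sr srP] := choice h; exists (\prod_t (sr t).1).
  elim/big_ind: _ => [|a b ha hb|t _]; first by rewrite idealr1.
    by rewrite prime_idealrM negb_or ha.
  by case: (srP t).
move=> t; exists (\prod_(i | i != t) (sr i).1 * (sr t).2).
by rewrite (bigD1 t) //= [(sr t).1 * _]mulrC rmorphM -mulrA (srP t).2 -rmorphM.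
Qed.

End LocAt.

Section DualBasis.
Variable R : comNzRingType.

Definition cartier q (phi : R -> R) :=
  {morph phi : x y / x + y} /\ forall a x, phi (a ^+ q * x) = a * phi x.

(* After inverting t, a dual basis of R over its subring of q-th powers. *)
Definition dual_basis q t := exists (T : finType) (pi : T -> R -> R) (b : T -> R),
  (forall i, cartier q (pi i)) /\ forall x, t ^+ q * x = \sum_i pi i x ^+ q * b i.

Variable p : nat.
Hypotheses (charR : p \in [pchar R]) (regR : regular R).
Variables (N : nat) (h : 'I_N -> R).
Hypothesis gen : frob_gen p h.

(** The coordinate maps of a Frobenius basis of the localization descend to R after clearing
    finitely many denominators, since R is finite over its p-th powers. *)
Lemma dual_basis_at (P : prime_idealr R) : exists2 t, t \notin P & dual_basis p t.
Proof.
have [nR regP] := regR; have p0 := char_gt0 charR.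
have [c cE] := choice gen.
pose S := loc_at P; pose iota : R -> S := @to_loc_at R P.
have iD a b : iota (a + b) = iota a + iota b by rewrite /iota rmorphD.
have iB a b : iota (a - b) = iota a - iota b by rewrite /iota rmorphB.
have iM a b : iota (a * b) = iota a * iota b by rewrite /iota rmorphM.
have iX a n : iota (a ^+ n) = iota a ^+ n by rewrite /iota rmorphXn.
have isum (T : finType) (F : T -> R) : iota (\sum_i F i) = \sum_i iota (F i).
  by rewrite /iota rmorph_sum.
have charS : p \in [pchar S].
  apply/andP; split; first exact: pcharf_prime charR.
  by have := rmorph_nat (@to_loc_at R P) p; rewrite (pcharf0 charR) rmorph0 => <-.
have genS : frob_gen p (iota \o h).
  move=> x; have [s sP [a ea]] := loc_at_num x; have [v ev] := to_loc_at_unit sP.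
  exists (fun i => v * iota (c (s ^+ p.-1 * a) i)).
  (* Writing a / s as (s^(p-1) a) / s^p turns the denominator into a p-th power. *)
  have -> : x = v ^+ p * iota (s ^+ p.-1 * a).
    rewrite iM iX -(ea : iota s * x = iota a) -[in LHS](mul1r x).
    rewrite -(expr1n _ p) -{1}(ev : v * iota s = 1) exprMn -{2}(prednK p0) exprSr.
    by ring.
  rewrite {1}(cE (s ^+ p.-1 * a)) isum mulr_sumr; apply: eq_bigr => i _.
  by rewrite iM iX exprMn mulrA.
have [n [g [genG freeG]]] := regular_local_frob_basis charS (regP P) genS.
have [co coE] := choice genG.
have co_uniq x e : x = frob_comb p g e -> forall i, co x i = e i.
  move=> ex i; apply/eqP; rewrite -subr_eq0; apply/eqP; apply: (freeG (fun i => co x i - e i)).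
  by rewrite -(frob_combB charS) -coE -ex subrr.
have coD x y i : co (x + y) i = co x i + co y i.
  apply: (co_uniq _ (fun i => co x i + co y i)).
  by rewrite -(frob_combD charS) -!coE.
have coM a x i : co (a ^+ p * x) i = a * co x i.
  apply: (co_uniq _ (fun i => a * co x i)).
  by rewrite -frob_combM -coE.
have hg i : exists vb : S * R, g i = vb.1 ^+ p * iota vb.2.
  have [s sP [a ea]] := loc_at_num (g i); have [v ev] := to_loc_at_unit sP.
  exists (v, s ^+ p.-1 * a) => /=.
  rewrite iM iX -(ea : iota s * g i = iota a) -[in LHS](mul1r (g i)).
  rewrite -(expr1n _ p) -{1}(ev : v * iota s = 1) exprMn -{2}(prednK p0) exprSr.
  by ring.
have [vb vbE] := choice hg.
pose rho i x := (vb i).1 * co (iota x) i.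
have rhoD i x y : rho i (x + y) = rho i x + rho i y by rewrite /rho iD coD mulrDr.
have rhoM i a x : rho i (a ^+ p * x) = iota a * rho i x.
  by rewrite /rho iM iX coM mulrCA.
have rho0 i : rho i 0 = 0 by apply: (addrI (rho i 0)); rewrite -rhoD !addr0.
have rhoE x : iota x = \sum_i rho i x ^+ p * iota (vb i).2.
  rewrite {1}(coE (iota x)); apply: eq_bigr => i _.
  by rewrite {1}vbE exprMn; ring.
have [s sP sE] := loc_at_common_denom (fun ij : 'I_n * 'I_N => rho ij.1 (h ij.2)).
have [r rE'] := choice sE.
have rE ij : iota s * rho ij.1 (h ij.2) = iota (r ij) by exact: rE'.
pose ker := [set z | iota z = 0].
have hker : ideal ker.
  split=> [|x y /= ex ey|a x /= ex]; first exact: rmorph0.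
    by rewrite /ker /= iD ex ey addr0.
  by rewrite /ker /= iM ex mulr0.
have hP : ideal [set x | x \in P] by exact: ideal_idealr.
have pP : prime_set [set x | x \in P] by move=> x y /=; rewrite prime_idealrM => /orP.
have [||k Pk kE] := @uniform_multiplier R [set x | x \in P] _ pP nR [set 0] ker
  (@ideal_zero R) hker.
- by rewrite /= idealr1.
- move=> z /= ez; have [|u uP eu] := @to_loc_at_eq R P z 0; first by rewrite rmorph0.
  by exists u; [apply/negP|rewrite /= eu mulr0].
have kill a b : iota a = iota b -> k * a = k * b.
  move=> e; apply/eqP; rewrite -subr_eq0 -mulrBr; apply/eqP; apply: kE.
  by rewrite /ker /= iB e subrr.
(* [tau] lifts [s * rho] to R. The coefficients [c x j] are arbitrary choices, so it is additive and
   p^-1-linear only modulo the kernel of localization; the factor [k] kills that kernel. *)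
pose tau i x := \sum_j c x j * r (i, j).
have tauE i x : iota (tau i x) = iota s * rho i x.
  rewrite isum [in RHS](cE x) (big_morph (rho i) (rhoD i) (rho0 i)) mulr_sumr.
  by apply: eq_bigr => j _; rewrite iM -rE rhoM mulrCA.
exists (k * s); first by rewrite prime_idealrM negb_or sP andbT; apply/negP.
exists 'I_n, (fun i x => k * tau i x), (fun i => (vb i).2); split.
  move=> i; split=> [x y|a x].
    rewrite -mulrDr; apply: kill; rewrite iD !tauE rhoD mulrDr //.
  rewrite mulrCA; apply: kill; rewrite iM !tauE rhoM; ring.
move=> x; transitivity (k ^+ p * \sum_i tau i x ^+ p * (vb i).2); last first.
  by rewrite mulr_sumr; apply: eq_bigr => i _; rewrite exprMn mulrA.
rewrite exprMn -mulrA -(prednK p0) exprSr -!mulrA prednK //; congr (_ * _).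
apply: kill; rewrite isum iM iX (rhoE x) mulr_sumr; apply: eq_bigr => i _.
by rewrite iM iX tauE [(iota s * _) ^+ p]exprMn mulrA.
Qed.

(** The t that admit a dual basis form an ideal: families for s and t combine on the disjoint union
    because (s + t)^p = s^p + t^p. By the local case no prime contains this ideal. *)
Lemma dual_basis1 : dual_basis p 1.
Proof.
have [nR _] := regR; have p0 := char_gt0 charR.
have hT : ideal [set t | dual_basis p t].
  split=> [|s t [T [pi [b [pil piE]]]] [T' [pi' [b' [pil' piE']]]]|a t [T [pi [b [pil piE]]]]].
  - exists void, (fun=> id), (fun=> 0); split=> [[]|x].
    by rewrite big_pred0 ?expr0n ?gtn_eqF ?mul0r //; case.
  - exists (T + T')%type, (fun i => match i with inl i => pi i | inr i => pi' i end),
      (fun i => match i with inl i => b i | inr i => b' i end); split.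
      by case.
    by move=> x; rewrite big_sumType /= -piE -piE' frobD // mulrDl.
  - exists T, (fun i x => a * pi i x), b; split=> [i|x].
      have [pD pM] := pil i; split=> [x y|c x]; first by rewrite pD mulrDr.
      by rewrite pM mulrCA.
    rewrite exprMn -mulrA piE mulr_sumr; apply: eq_bigr => i _.
    by rewrite exprMn mulrA.
apply: contrapT => n1.
have [||Q [[hQ Q1 pQ] TQ _]] := exists_prime_disjoint nR (T := [set 1]) hT erefl.
- by move=> _ _ -> ->; rewrite mulr1.
- by move=> x Tx x1; apply: n1; rewrite -[X in dual_basis _ X]x1.
have [K KQ] := prime_idealrP hQ Q1 pQ.
have [t /negP tK ht] := dual_basis_at K.
by apply/tK/KQ/TQ.
Qed.

End DualBasis.

(** * Stationarity of the chain of root ideals *)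

Lemma ideal_chain_stable (R : comNzRingType) (p : nat) (J : nat -> set R) :
    noetherian R -> (1 < p)%N -> (forall n, ideal (J n)) -> (forall z, J 0%N z) ->
    (forall m n x, (forall y, J m y -> J n (x ^+ p * y)) ->
      forall z, J m.+1 z -> J n.+1 (x * z)) ->
  exists n0, forall n, J n0 `<=` J (n0 + n)%N.
Proof.
move=> nR p1 hJ J0 JS.
have Jd n : J n.+1 `<=` J n.
  elim: n => [|n IH] z Jz //; rewrite -[z]mul1r; apply: JS Jz => y Jy.
  by rewrite expr1n mul1r; exact: IH.
have Jle n k : J (n + k)%N `<=` J n.
  elim: k => [|k IH]; rewrite ?addn0 ?addnS //; exact: subset_trans (Jd _) IH.
have Jx n x y : J n y -> J n (x * y) by exact: idealM.
(* The annihilator of the n-th layer. It grows with n, because x in [a n] gives x^p J_n <=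
   J_{n+1}. *)
pose a n := colon (J n.+1) (J n).
have aS n : a n `<=` a n.+1.
  move=> x ax z Jz; apply: JS Jz => y Jy.
  by rewrite -(prednK (ltnW p1)) exprSr -mulrA; apply/Jx/ax.
have [||_ [n0 _ <-] amax] := @noetherian_max _ nR (range a).
- by move=> _ [n _ <-]; exact: ideal_colon.
- by exists (a 0%N), 0%N.
have a0 k : a (n0 + k)%N `<=` a n0.
  apply: amax; first by exists (n0 + k)%N.
  elim: k => [|k IH]; rewrite ?addn0 ?addnS //; exact: subset_trans IH (aS _).
exists n0; apply: contrapT => unstable.
have a1 : ~ a n0 1.
  move=> a1; apply: unstable; elim=> [|n IH] z Jz; first by rewrite addn0.
  have : a (n0 + n)%N 1.
    by elim: (n) => [|k h]; rewrite ?addn0 ?addnS //; exact: aS.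
  by rewrite addnS -[z]mul1r; apply; exact: IH.
(* The idea of Gabber: x kills one layer, so x ^ 2 kills all of them. *)
have sq x : a n0 x -> forall n y, J n0 y -> J (n0 + n)%N (x ^+ 2 * y).
  move=> ax; elim=> [|n IH] y Jy; first by rewrite addn0; exact: Jx.
  rewrite addnS expr2 -mulrA; apply: (JS n0); last exact: ax.
  by move=> z Jz; rewrite -(subnK p1) exprD -mulrA; apply/Jx/IH.
pose b := [set x | forall n y, J n0 y -> J (n0 + n)%N (x * y)].
have hb : ideal b.
  split=> [n y _|x x' bx bx' n y Jy|c x bx n y Jy].
  - by rewrite mul0r; exact: ideal0.
  - by rewrite mulrDl; apply: idealD => //; [exact: bx|exact: bx'].
  - by rewrite -mulrA; apply/Jx/bx.
have b1 : ~ b 1.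
  by move=> b1; apply: a1 => y Jy; have := b1 1%N y Jy; rewrite addn1.
have [P [s [[hP nP pP] bP Ps Pnil]]] := exists_minimal_prime nR hb b1.
have aP x : a n0 x -> P x.
  by move=> /sq bx; apply: (prime_exp (n := 2) pP nP); exact: bP.
(* As P is minimal over [b], for y in P a power of s y lies in [b] and so sends [J n0] into all
   later ideals. *)
have dcc : loc_dcc P [set z | forall n, J (n0 + n)%N z] (J n0).
  apply: loc_dcc_nilp => //.
  - split=> [n|x y hx hy n|c x hx n]; [exact: ideal0|exact: idealD|exact: idealM].
  - by move=> z /(_ 0%N); rewrite addn0.
  - move=> y g /Pnil[k bk] Jg; exists (s ^+ k); first by move/(prime_exp pP nP).
    by exists k => n; rewrite mulrA -exprMn; exact: bk.
have [||||n1 st] := dcc (fun n => J (n0 + n)%N).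
- by [].
- by move=> n; rewrite addnS.
- by move=> n z; exact.
- by move=> n; exact: Jle.
(* Now t outside P kills a layer beyond [n0], so it lies in [a n0], which is contained in P: a
   contradiction. *)
have [t Pt ht] := st n1 (leqnn _).
by apply/Pt/aP/(a0 n1) => y Jy; have := ht y Jy; rewrite addnS.
Qed.

(** * F-finiteness *)

Section FFinite.
Variables (p : nat) (A : comNzRingType) (R : comAlgType A).
Hypotheses (charA : p \in [pchar A]) (FfinA : F_finite p A) (fgR : fin_gen_algebra R).

Lemma pchar_alg : p \in [pchar R].
Proof.
apply/andP; split; first exact: pcharf_prime charA.
by rewrite -[p%:R]/(1 *+ p) -scaler_nat (pcharf0 charA) scale0r.
Qed.

Definition pth_powers := [set c : R | exists a, c = a ^+ p].

Lemma pth_powers_subgroup : subgroup pth_powers.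
Proof.
split; first by exists 0; rewrite expr0n gtn_eqF // (char_gt0 charA).
by move=> _ _ [a ->] [b ->]; exists (a + b); rewrite (frobD pchar_alg).
Qed.

Lemma pspanM s c x : span_in pth_powers s x -> span_in pth_powers s (c ^+ p * x).
Proof. by apply: span_inM => _ [a ->]; exists (c * a); rewrite exprMn. Qed.

Lemma pspan_ind s (D : set R) : subgroup D ->
  (forall a c, a \in s -> D (c ^+ p * a)) -> span_in pth_powers s `<=` D.
Proof. by move=> sD h; apply: span_in_sub sD _ => a _ /h{}h [c ->]. Qed.

Lemma pspan_mul_closed s :
    (forall a b, a \in s -> b \in s -> span_in pth_powers s (a * b)) ->
  forall x y, span_in pth_powers s x -> span_in pth_powers s y ->
    span_in pth_powers s (x * y).
Proof.
have sp := pth_powers_subgroup; move=> h x y hx hy; move: x hx.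
apply: pspan_ind => [|a c hs] /=.
  split=> [|x x' hx hx'] /=; first by rewrite mul0r; exact: span_in0.
  by rewrite mulrDl; exact: span_inD.
rewrite -mulrA; apply: pspanM; move: y hy; apply: pspan_ind => [|b d hb] /=.
  split=> [|x x' hx hx'] /=; first by rewrite mulr0; exact: span_in0.
  by rewrite mulrDr; exact: span_inD.
by rewrite mulrCA; apply: pspanM; exact: h.
Qed.

(** Adjoining an algebra generator t multiplies the old module generators by t^j with j < p; higher
    powers reduce since t^k is t^(k mod p) times a p-th power. *)
Lemma alg_pspan (s : seq R) : exists g : seq R,
  [/\ forall x y, span_in pth_powers g x -> span_in pth_powers g y ->
        span_in pth_powers g (x * y),
      forall a : A, span_in pth_powers g a%:A
    & {in s, forall x, span_in pth_powers g x}].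
Proof.
have sp := pth_powers_subgroup.
elim: s => [|t s [g [gM gA gs]]].
  have [g gE] := FfinA; exists [seq a%:A | a <- g].
  have gA a : span_in pth_powers [seq a%:A | a <- g] a%:A.
    have [c ->] := gE a; rewrite scaler_suml.
    elim/big_ind: _ => [|x y|i _]; first exact: span_in0.
      exact: span_inD.
    rewrite -scalerA -mulr_algl; apply: span_in_mem => //.
      by apply: map_f; exact: mem_nth.
    by exists (c i)%:A; rewrite exprZn expr1n.
  split=> //; apply: pspan_mul_closed => _ _ /mapP[a _ ->] /mapP[b _ ->].
  by rewrite mulr_algl scalerA.
pose g' := [seq x * t ^+ j | x <- g, j <- iota 0 p].
have p0 := char_gt0 charA.
have gt k x : span_in pth_powers g x -> span_in pth_powers g' (x * t ^+ k).
  move: x; apply: pspan_ind => [|a c ag] /=.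
    split=> [|x x' hx hx'] /=; first by rewrite mul0r; exact: span_in0.
    by rewrite mulrDl; exact: span_inD.
  have -> : c ^+ p * a * t ^+ k = (c * t ^+ (k %/ p)) ^+ p * (a * t ^+ (k %% p)).
    by rewrite {1}(divn_eq k p) exprD exprM exprMn; ring.
  apply: span_in_mem => //; last by exists (c * t ^+ (k %/ p)).
  by apply: allpairs_f => //; rewrite mem_iota ltn_mod.
have gg' x : span_in pth_powers g x -> span_in pth_powers g' x.
  by move=> /(gt 0%N); rewrite mulr1.
exists g'; split.
- apply: pspan_mul_closed => _ _ /allpairsP[[a i] [/= ag _ ->]] /allpairsP[[b j] [/= bg _ ->]].
  rewrite mulrACA -exprD; apply: gt; apply: gM; rewrite -[X in span_in _ _ X]mul1r;
    by apply: span_in_mem => //; exists 1; rewrite expr1n.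
- by move=> a; apply: gg'.
- move=> x; rewrite inE => /predU1P[->|/gs/gg'//].
  by rewrite -[t]mul1r -[t in _ * t]expr1 -[1]scale1r; apply: gt.
Qed.

Lemma F_finite_alg : exists N (h : 'I_N -> R), frob_gen p h.
Proof.
have sp := pth_powers_subgroup.
have [s sgen] := fgR; have [g [gM gA gs]] := alg_pspan s.
exists (size g), (fun i => g`_i) => x.
have : x \in [pred x | `[< span_in pth_powers g x >]].
  apply: (sgen [pred x | `[< span_in pth_powers g x >]]); last first.
    by move=> y /gs h; apply/asboolP.
  split.
  - by apply/asboolP; rewrite -[1]scale1r; exact: gA.
  - move=> a u v /asboolP hu /asboolP hv; apply/asboolP.
    by apply: span_inD => //; rewrite -mulr_algl; exact: gM.
  - by move=> u v /asboolP hu /asboolP hv; apply/asboolP; exact: gM.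
move=> /asboolP/span_inP[c [cp ->]].
have [e eE] := choice cp; exists e.
by apply: eq_bigr => i _; rewrite eE.
Qed.

End FFinite.

(** * Differential operators from Frobenius-linear maps *)

Section FrobeniusPowers.
Variables (R : comNzRingType) (p : nat).
Hypothesis charR : p \in [pchar R].

Lemma frobXD e (x y : R) : (x + y) ^+ (p ^ e) = x ^+ (p ^ e) + y ^+ (p ^ e).
Proof.
by elim: e => [|e IH]; rewrite ?expr1 // expnSr !exprM IH (frobD charR).
Qed.

Lemma frobX_sum e (T : finType) (F : T -> R) :
  (\sum_i F i) ^+ (p ^ e) = \sum_i F i ^+ (p ^ e).
Proof.
apply: (big_morph (fun x => x ^+ (p ^ e))) => [x y|]; first exact: frobXD.
by rewrite expr0n gtn_eqF // expn_gt0 (char_gt0 charR).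
Qed.

Lemma cartier_sum q phi (T : finType) (F : T -> R) : cartier q phi ->
  phi (\sum_i F i) = \sum_i phi (F i).
Proof.
move=> [phiD _]; apply: big_morph => //.
by apply: (addrI (phi 0)); rewrite -phiD !addr0.
Qed.

(** The p-th roots of the coefficients in one expansion are expanded again, and the result is raised
    to the power p; hence the new elements b'_j^p b_i. *)
Lemma dual_basisX e : dual_basis (R := R) p 1 -> dual_basis (R := R) (p ^ e) 1.
Proof.
move=> [T [pi [b [pil piE]]]]; elim: e => [|e [T' [pi' [b' [pil' piE']]]]].
  exists unit, (fun=> id), (fun=> 1); split=> // x.
  by rewrite big_const card_unit /= addr0 expr1 mulr1 mul1r.
exists (T * T')%type, (fun ij x => pi' ij.2 (pi ij.1 x)), (fun ij => b' ij.2 ^+ p * b ij.1).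
split=> [[i j] /=|x].
  have [piD piM] := pil i; have [piD' piM'] := pil' j.
  split=> [x y|a x]; first by rewrite piD piD'.
  by rewrite expnSr exprM piM piM'.
rewrite expr1n -(expr1n _ p) piE -(pair_bigA _ (fun i j =>
  pi' j (pi i x) ^+ (p ^ e.+1) * (b' j ^+ p * b i))) /=.
apply: eq_bigr => i _; rewrite -[pi i x in LHS]mul1r -(expr1n _ (p ^ e)) piE'.
have /= -> := frobX_sum 1 (fun j => pi' j (pi i x) ^+ (p ^ e) * b' j).
rewrite mulr_suml; apply: eq_bigr => j _.
by rewrite expn1 exprMn -exprM -expnSr mulrA.
Qed.

(** Linearity over the q-th powers, where [cartier q] asks for q^-1-linearity. *)
Definition frob_linear q (d : R -> R) :=
  {morph d : x y / x + y} /\ forall a x, d (a ^+ q * x) = a ^+ q * d x.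

Lemma commr_frob_linear q d r : frob_linear q d -> frob_linear q (commr d r).
Proof.
by move=> [dD dM]; split=> [x y|a x]; rewrite /commr ?[r * (a ^+ q * _)]mulrCA
  ?mulrDr ?dD ?dM; ring.
Qed.

Definition ad (r : R) (d : R -> R) := commr d r.

Lemma commrC (d : R -> R) r s : commr (commr d r) s = commr (commr d s) r.
Proof. by apply/funext => x; rewrite /commr [s * (r * x)]mulrCA; ring. Qed.

(** The linear functional on polynomials that sends X^k to [u k]; it transfers identities between
    polynomials to iterated brackets. *)
Definition coef_eval (u : nat -> R) (P : {poly R}) := \sum_(k < size P) P`_k * u k.

Lemma coef_eval_widen u (P : {poly R}) n : (size P <= n)%N ->
  coef_eval u P = \sum_(k < n) P`_k * u k.
Proof.
move=> le_n; rewrite /coef_eval (big_ord_widen n (fun k => P`_k * u k)) // big_mkcond.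
by apply: eq_bigr => k _; case: ltnP => // h; rewrite nth_default // mul0r.
Qed.

Lemma coef_evalXsubC u (P : {poly R}) r :
  coef_eval u (P * ('X - r%:P)) = coef_eval (fun k => u k.+1 - r * u k) P.
Proof.
rewrite (@coef_eval_widen u _ (size P).+1); last first.
  rewrite (leq_trans (size_polyMleq _ _)) // size_XsubC addn2 //.
transitivity (\sum_(k < (size P).+1) (P * 'X)`_k * u k
              - \sum_(k < (size P).+1) (P`_k * r) * u k).
  rewrite -sumrB; apply: eq_bigr => k _.
  by rewrite mulrBr coefB coefMC mulrBl.
rewrite big_ord_recl coefMX mul0r add0r big_ord_recr /= nth_default // mul0r mul0r addr0.
rewrite -sumrB; apply: eq_bigr => k _.
by rewrite coefMX /=; ring.
Qed.

(* In characteristic p, ad(r)^(p^e) = ad(r^(p^e)). *)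
Lemma iter_commr e (d : R -> R) r : frob_linear (p ^ e) d ->
  iter (p ^ e) (ad r) d = fun=> 0.
Proof.
move=> [_ dM]; apply/funext => x.
(* For P = 1 this evaluates (X - r)^n with X^k sent to [d (r ^+ k * x)]; a general P is needed for
   the induction. *)
have it n (P : {poly R}) : coef_eval (fun k => iter n (ad r) d (r ^+ k * x)) P =
    coef_eval (fun k => d (r ^+ k * x)) (P * ('X - r%:P) ^+ n).
  elim: n P => [|n IH] P; first by rewrite mulr1.
  rewrite exprS mulrA -IH coef_evalXsubC; apply: eq_bigr => k _.
  by rewrite /= /ad /commr exprS mulrA.
have := it (p ^ e)%N 1; rewrite mul1r {1}/coef_eval size_poly1 big_ord1.
rewrite coef1 /= mul1r expr0 !mul1r => ->.
have -> : ('X - r%:P) ^+ (p ^ e) = 'X^(p ^ e) - (r ^+ (p ^ e))%:P :> {poly R}.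
  have charP : p \in [pchar {poly R}] by rewrite pchar_poly.
  elim: e {dM it} => [|e IH]; first by rewrite !expr1.
  rewrite expnSr exprM IH -[LHS]/(pFrobenius_aut charP _) rmorphB /=.
  by rewrite !pFrobenius_autE !polyC_exp -!exprM.
have q0 : (0 < p ^ e)%N by rewrite expn_gt0 (char_gt0 charR).
rewrite (@coef_eval_widen _ _ (p ^ e).+1); last first.
  by rewrite size_XnsubC.
transitivity (\sum_(k < (p ^ e).+1) (k == (p ^ e)%N :> nat)%:R * d (r ^+ k * x) -
  \sum_(k < (p ^ e).+1) (if k == 0%N :> nat then r ^+ (p ^ e) else 0) * d (r ^+ k * x)).
  by rewrite -sumrB; apply: eq_bigr => k _; rewrite coefB coefXn coefC mulrBl.
rewrite big_ord_recr [X in _ - X]big_ord_recl /= eqxx !big1 ?addr0 ?add0r => [|k _|k _].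
- by rewrite mul1r mul1r dM subrr.
- by rewrite mul0r.
- by rewrite ltn_eqF // mul0r.
Qed.

Lemma diff_order_sum n (T : finType) (F : T -> R -> R) :
  (forall i, diff_order n (F i)) -> diff_order n (fun x => \sum_i F i x).
Proof.
move=> hF; elim: (index_enum T) => [|i s IH].
  rewrite (_ : (fun _ => _) = fun=> 0); first exact: diff_order0.
  by apply/funext => x; rewrite big_nil.
rewrite (_ : (fun _ => _) = fun x => F i x + \sum_(j <- s) F j x).
  exact: diff_orderD.
by apply/funext => x; rewrite big_cons.
Qed.

Lemma ad0 r : ad r (fun=> 0) = fun=> 0.
Proof. by apply/funext => x; rewrite /ad /commr mulr0 subrr. Qed.

Lemma iter_adC n r s d : iter n (ad r) (ad s d) = ad s (iter n (ad r) d).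
Proof. by elim: n => //= n ->; exact: commrC. Qed.

Section DiffOrder.
Variables (e : nat) (T : finType) (b : T -> R).
Hypothesis gen : forall r, exists c, r = \sum_i c i ^+ (p ^ e) * b i.

Lemma ad_gen c d x : frob_linear (p ^ e) d ->
  ad (\sum_i c i ^+ (p ^ e) * b i) d x = \sum_i c i ^+ (p ^ e) * ad (b i) d x.
Proof.
move=> [dD dM]; have d0 : d 0 = 0 by apply: (addrI (d 0)); rewrite -dD !addr0.
rewrite /ad /commr !mulr_suml (big_morph d dD d0) -sumrB.
by apply: eq_bigr => i _; rewrite -!mulrA dM mulrBr.
Qed.

(** A bracket with any r is a combination of brackets with the [b i]. Each of these lowers one
    exponent and keeps the other bounds, because brackets commute. *)
Lemma iter_ad_diff_order M (a : T -> nat) d : frob_linear (p ^ e) d ->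
    (forall i, iter (a i) (ad (b i)) d = fun=> 0) -> (\sum_i a i <= M)%N ->
  diff_order M.+1 d.
Proof.
elim: M a d => [|M IH] a d dl da le_M; split; try exact: dl.1; move=> r;
  have [c ->] := gen r;
  rewrite -[commr d _]/(ad _ d) (funext (fun x => ad_gen c x dl));
  apply: diff_order_sum => i; apply: diff_orderMl; have [ai|ai] := posnP (a i).
- by have := da i; rewrite ai /= => ->; rewrite ad0; exact: (diff_order0 R 0).
- by move: le_M; rewrite (bigD1 i) //=; lia.
- by have := da i; rewrite ai /= => ->; rewrite ad0; exact: (diff_order0 R M.+1).
apply: (IH (upd a i (a i).-1)) (commr_frob_linear (b i) dl) _ _.
  move=> j; rewrite /upd; case: eqP => [->|_]; last by rewrite iter_adC da ad0.
  by rewrite -iterSr prednK.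
rewrite -ltnS; apply: leq_trans le_M; apply: sum_upd; lia.
Qed.

Lemma frob_linear_diff_order d : frob_linear (p ^ e) d -> exists n, diff_order n d.
Proof.
move=> dl; exists (\sum_(i : T) p ^ e)%N.+1.
by apply: (iter_ad_diff_order (a := fun=> (p ^ e)%N)) => // i; exact: iter_commr.
Qed.
End DiffOrder.

(** * The root ideals of f and the operators obtained from their stationarity *)

Section Hypersurface.
Hypotheses (nR : noetherian R) (db : dual_basis (R := R) p 1).
Variable f : R.

(* I_e(f ^ (p ^ e - 1)), the smallest ideal whose p ^ e-th Frobenius power
   contains f ^ (p ^ e - 1). *)
Definition root_ideal e : set R :=
  [set z | exists2 phi, cartier (p ^ e) phi & z = phi (f ^+ (p ^ e).-1)].

Lemma ideal_root_ideal e : ideal (root_ideal e).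
Proof.
split.
- exists (fun=> 0) => //; split=> [x y|a x]; first by rewrite addr0.
  by rewrite mulr0.
- move=> _ _ [phi [pD pM] ->] [psi [qD qM] ->]; exists (fun x => phi x + psi x) => //.
  by split=> [x y|a x]; rewrite ?pD ?qD ?pM ?qM; ring.
- move=> c _ [phi [pD pM] ->]; exists (fun x => c * phi x) => //.
  by split=> [x y|a x]; rewrite ?pD ?pM; ring.
Qed.

Lemma root_ideal0 z : root_ideal 0 z.
Proof.
exists ( *%R z); last by rewrite mulr1.
by split=> [x y|a x]; rewrite ?expr1; ring.
Qed.

Lemma exp_predXS n : ((p ^ n.+1).-1 = p ^ n * p.-1 + (p ^ n).-1)%N.
Proof.
have p0 := char_gt0 charR; have q0 : (0 < p ^ n)%N by rewrite expn_gt0 p0.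
have -> : (p ^ n.+1 = p ^ n * p.-1 + p ^ n)%N by rewrite -mulnSr prednK // -expnSr.
by lia.
Qed.

(** Factor f^(p^(m+1) - 1) as (f^(p-1))^(p^m) f^(p^m - 1) and expand the last factor in a dual
    basis. The coefficient roots lie in J_m, so x^p moves them into J_n, where they are values
    [chi i] of f^(p^n - 1); the p^-1-linear maps [theta i] then lead to J_{n+1}. *)
Lemma root_idealS m n x : (forall y, root_ideal m y -> root_ideal n (x ^+ p * y)) ->
  forall z, root_ideal m.+1 z -> root_ideal n.+1 (x * z).
Proof.
move=> mn _ [psi psil ->]; have [T [pi [b [pil piE]]]] := dual_basisX m db.
have [psiD psiM] := psil.
have /choice[chi chiP] : forall i, exists phi, cartier (p ^ n) phi /\
    x ^+ p * pi i (f ^+ (p ^ m).-1) = phi (f ^+ (p ^ n).-1).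
  move=> i; have [|phi phil e] := mn (pi i (f ^+ (p ^ m).-1)).
    by exists (pi i).
  by exists phi.
pose theta i y := psi (y ^+ (p ^ m) * b i).
have thD i : {morph theta i : y y' / y + y'}.
  by move=> y y'; rewrite /theta frobXD mulrDl psiD.
have thM i a y : theta i (a ^+ p * y) = a * theta i y.
  by rewrite /theta exprMn -exprM -expnS -mulrA psiM.
exists (fun y => \sum_i theta i (chi i y)).
  split=> [y y'|a y].
    rewrite -big_split; apply: eq_bigr => i _.
    by have [[chiD _] _] := chiP i; rewrite chiD thD.
  rewrite mulr_sumr; apply: eq_bigr => i _.
  by have [[_ chiM] _] := chiP i; rewrite expnS exprM chiM thM.
rewrite -psiM exp_predXS exprD.
have -> : x ^+ (p ^ m.+1) * (f ^+ (p ^ m * p.-1) * f ^+ (p ^ m).-1) =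
    \sum_i (x ^+ p * f ^+ p.-1 * pi i (f ^+ (p ^ m).-1)) ^+ (p ^ m) * b i.
  rewrite -[f ^+ (p ^ m).-1 in LHS]mul1r -[X in X * f ^+ _](expr1n _ (p ^ m)) piE.
  rewrite !mulr_sumr; apply: eq_bigr => i _.
  by rewrite !exprMn -!exprM -expnS [(p.-1 * _)%N]mulnC !mulrA.
rewrite (cartier_sum _ psil); apply: eq_bigr => i _; rewrite /theta.
have [[_ chiM] e] := chiP i.
by rewrite exp_predXS exprD mulnC exprM chiM -e; congr (psi (_ ^+ _ * _)); ring.
Qed.

Lemma root_ideal_stable : exists e, forall n, root_ideal e `<=` root_ideal (e + n).
Proof.
have p1 : (1 < p)%N := prime_gt1 (pcharf_prime charR).
apply: (ideal_chain_stable nR p1); [exact: ideal_root_ideal|exact: root_ideal0|].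
exact: root_idealS.
Qed.

Lemma exists_frob_linear_root : exists e, forall k, exists d : R -> R,
  frob_linear (p ^ (e + k)) d /\
  d (f ^+ (p ^ (e + k)).-1) = f ^+ (p ^ (e + k) - p ^ k).
Proof.
have [e st] := root_ideal_stable; exists e => k.
have [T [pi [b [pil piE]]]] := dual_basisX e db.
have /choice[chi chiP] : forall i, exists phi, cartier (p ^ (e + k)) phi /\
    pi i (f ^+ (p ^ e).-1) = phi (f ^+ (p ^ (e + k)).-1).
  move=> i; have [|phi phil h] := st k (pi i (f ^+ (p ^ e).-1)).
    by exists (pi i).
  by exists phi.
(* At f^(q - 1), with q = p^(e+k), this is the p^k-th power of the expansion of f^(p^e - 1). *)
exists (fun x => \sum_i chi i x ^+ (p ^ (e + k)) * b i ^+ (p ^ k)); split.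
  split=> [x y|a x].
    rewrite -big_split; apply: eq_bigr => i _.
    by have [[chiD _] _] := chiP i; rewrite chiD frobXD mulrDl.
  rewrite mulr_sumr; apply: eq_bigr => i _.
  by have [[_ chiM] _] := chiP i; rewrite chiM exprMn mulrA.
have -> : (p ^ (e + k) - p ^ k = (p ^ e).-1 * p ^ k)%N.
  by rewrite expnD -subn1 mulnBl mul1n.
rewrite exprM -[f ^+ _ in RHS]mul1r -[X in X * f ^+ _](expr1n _ (p ^ e)) piE frobX_sum.
apply: eq_bigr => i _; have [_ <-] := chiP i.
by rewrite exprMn -exprM -expnD.
Qed.

End Hypersurface.
End FrobeniusPowers.

Theorem theorem4p1 (p : nat) (A : comNzRingType) (R : comAlgType A) (f : R)
    (charA : p \in [pchar A])
    (regA : regular_local A)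
    (FfinA : F_finite p A)
    (fgR : fin_gen_algebra R)
    (regR : regular R)
    (f_neq0 : f != 0) :
  @generated_by (diffop R) (loc (powers f)) (away_inv f).
Proof.
have charR := pchar_alg R charA.
have [N [h gen]] := F_finite_alg charA FfinA fgR.
have db := dual_basis1 charR regR gen.
have [e dE] := exists_frob_linear_root charR regR.1 db f.
elim/locfrac_ind=> r [s sf]; have /asboolP[m es] := sf; subst s.
have [d [dl df]] := dE m; set q := (p ^ (e + m))%N in d dl df *.
have [T [pi [b [pil piE]]]] := dual_basisX charR (e + m) db.
have [|n dn] := @frob_linear_diff_order _ _ charR (e + m) T b _ d dl.
  by move=> x; exists (fun i => pi i x); rewrite -piE expr1n mul1r.
have p1 : (1 < p)%N := prime_gt1 (pcharf_prime charR).
have le_m : (m <= p ^ m)%N by exact: ltnW (ltn_expl _ p1).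
have le_q : (p ^ m <= q)%N by rewrite leq_pexp2l ?leq_addl // ltnW.
have q0 : (0 < q)%N by rewrite expn_gt0 ltnW.
pose D : diffop R := DiffOp (ex_intro _ n dn).
(* [D] sends 1/f to 1/f^(p^m), and m <= p^m, so the remaining factor r f^(p^m - m) gives r/f^m. *)
exists (diffop_mulr (r * f ^+ (p ^ m - m)) * D).
have fqS : f ^+ q \in powers f by apply/asboolP; exists q.
apply: (@toloc_injl _ _ (Denom fqS)) => /=.
have wE : toloc (powers f) (f ^+ q) * away_inv f = toloc (powers f) (f ^+ q.-1).
  rewrite -(prednK q0) exprSr rmorphM -mulrA.
  by rewrite (toloc_inv (Denom (powers_id f))) mulr1.
(* Multiplication by f^q commutes with [D] because [d] is linear over q-th powers, and f^q / f is
   the image of f^(q-1), on which [D] acts as [d]. *)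
have DE : toloc (powers f) (f ^+ q) * (D *: away_inv f) = toloc (powers f) (f ^+ (q - p ^ m)).
  rewrite -df -[d _]/(D _) -loc_scale_toloc -wE -!loc_scale_mulr !scalerA.
  by congr (_ *: _); apply: diffopP => x /=; rewrite dl.2.
rewrite -scalerA loc_scale_mulr mulrCA DE -[in LHS](subnK (leq_trans le_m le_q)).
rewrite exprD rmorphM -mulrA (toloc_frac r (Denom sf)) -!rmorphM; congr (toloc _ _).
rewrite -mulrA -exprD mulrC; congr (_ * f ^+ _); lia.
Qed.
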